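(* Let $K=R[x,y]/(x(x-p),y(y-p))$ be the Kleinian 4-ring over $R$ and $A=K+Rz$ its minimal over-ring. For every $n\in\mathbb Z$ and every $m\ge1$: (1) If $f\in\mathbb P\setminus\{t,t-1,\infty\}$, then $\widehat H^n(K,T^f_m)\simeq\Bbbk^{dm}$, where $d=\deg f$. (2) If $\lambda\in\{0,1,\infty\}$ and $i\in\{1,2\}$, then $$\widehat H^n(K,T^{\lambda i}_m)\simeq\begin{cases}\Bbbk^{m/2}&\text{if } m\text{ is even},\\ \Bbbk^{(m-(-1)^{n+i})/2}&\text{if } m\text{ is odd}.\end{cases}$$ Here $T^f_m$ and $T^{\lambda i}_m$ are the indecomposable $A$-lattices lying in the homogeneous tubes $\mathcal T^f$ and in the exceptional tubes $\mathcal T^\lambda$ of the Auslander–Reiten quiver of $A$-lattices.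
   Context: $R$ is a complete discrete valuation ring with prime element $p$, field of fractions $Q$ and residue field $\Bbbk=R/pR$. $K=R[x,y]/(x(x-p),y(y-p))$ is embedded in $Q^4$ by $x\mapsto(p,p,0,0)$, $y\mapsto(p,0,p,0)$; $z=(p,0,0,0)$, $A=K+Rz$, a local ring with maximal ideal $\mathfrak m=(p,x,y,z)=pA^\sharp$, where $A^\sharp=R^4$. A lattice is a module finitely generated and free over $R$. For $\alpha,\beta\in\{0,p\}$, $R_{\alpha\beta}$ is $R$ with $x$ acting as $\alpha$ and $y$ as $\beta$. For an $A$-lattice $M$ let $M^\sharp=A^\sharp M=\bigoplus_{\alpha\beta}M^\sharp_{\alpha\beta}$, where $x$ acts as $\alpha$ and $y$ as $\beta$ on $M^\sharp_{\alpha\beta}$. Description of $A$-lattices. Let $\Gamma$ be the quiver with vertices $\bullet,pp,p0,0p,00$ and one arrow from $\bullet$ to each of the other four. To an $A$-lattice $M$ one attaches the representation $V=\Phi(M)$ of $\Gamma$ over $\Bbbk$ with $V_\bullet=M/\mathfrak mM$, $V_{\alpha\beta}=M^\sharp_{\alpha\beta}/pM^\sharp_{\alpha\beta}$ and the natural maps $f_{\alpha\beta}:V_\bullet\to V_{\alpha\beta}$ (note $\mathfrak mM=pM^\sharp$). This gives a bijection between isomorphism classes of $A$-lattices and isomorphism classes of representations $V$ with all $f_{\alpha\beta}$ surjective and $V_\bullet\to\bigoplus V_{\alpha\beta}$ injective; $M$ is recovered as the preimage of the image of $V_\bullet$ in $M^\sharp=\bigoplus R_{\alpha\beta}^{\dim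 V_{\alpha\beta}}$. The vector rank is $\mathrm{Rk}\,M=(d_\bullet\mid d_{pp},d_{p0},d_{0p},d_{00})$, the dimension vector of $\Phi(M)$. Tubes. The regular components of the Auslander–Reiten quiver of $A$-lattices (those corresponding to the regular components for $\Gamma$) are tubes parametrized by $\mathbb P=\{\text{monic irreducible polynomials } f(t)\in\Bbbk[t]\}\cup\{\infty\}$; $\mathcal T^\lambda$ means $\mathcal T^{t-\lambda}$ for $\lambda\in\Bbbk$. For $f\ne t,t-1,\infty$, $d=\deg f$, the tube $\mathcal T^f$ is homogeneous ($\tau_KM\simeq M$ for all its lattices, where $\tau_K$ is the Auslander–Reiten translate of $K$-lattices) and consists of indecomposable lattices $T^f_m$, $m\ge1$, with $\mathrm{Rk}\,T^f_m=(2dm\mid dm,dm,dm,dm)$; $T^f_1$ corresponds to the representation $V_\bullet=\Bbbk^{2d}$, $V_{\alpha\beta}=\Bbbk^d$, $f_{pp}=(I\ 0)$, $f_{p0}=(0\ I)$, $f_{0p}=(I\ I)$, $f_{00}=(I\ F)$ with $F$ the Frobenius (companion) matrix with characteristic polynomial $f$, and there are exact sequences $0\to T^f_1\to T^f_{m+1}\to T^f_m\to0$ and $0\to T^f_m\to T^f_{m+1}\to T^f_1\to0$. For $\lambda\in\{0,1,\infty\}$ the tube $\mathcal T^\lambda$ is exceptional of rank 2 and consists of indecomposable lattices $T^{\lambda i}_m$, $i\in\{1,2\}$, $m\ge1$, with $\tau_KT^{\lambda1}_m=T^{\lambda2}_m$ and $\tau_KT^{\lambda2}_m=T^{\lambda1}_m$.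 There are irreducible monomorphisms $T^{\lambda i}_m\to T^{\lambda i}_{m+1}$ with cokernel $T^{\lambda j}_1$, where $j=i$ if $m$ is even and $j\ne i$ if $m$ is odd, and irreducible epimorphisms $T^{\lambda i}_{m+1}\to T^{\lambda j}_m$ ($j\neq i$) with kernel $T^{\lambda i}_1$. For $\lambda=1$: $\mathrm{Rk}\,T^{1i}_{2m}=(2m\mid m,m,m,m)$, $\mathrm{Rk}\,T^{11}_{2m-1}=(2m-1\mid m,m,m-1,m-1)$, $\mathrm{Rk}\,T^{12}_{2m-1}=(2m-1\mid m-1,m-1,m,m)$. The vector ranks for $\lambda=0$ (respectively $\lambda=\infty$) are obtained from these by interchanging $d_{p0}$ with $d_{00}$ (respectively with $d_{0p}$). Tate cohomology. $R$ is a $K$-module via $x,y\mapsto p$; $H_n(K,M)=\mathrm{Tor}^K_n(R,M)$, $H^n(K,M)=\mathrm{Ext}_K^n(R,M)$. $\widehat H^n(K,M)=H^n(K,M)$ for $n>0$; $\widehat H^n(K,M)=H_{-n-1}(K,M)$ for $n<-1$; $\widehat H^0(K,M)=\{m\in M\mid xm=ym=pm\}/xyM$; $\widehat H^{-1}(K,M)=\{m\in M\mid xym=0\}/((x-p)M+(y-p)M)$. *)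

(* Defs.v *)
From HB Require Import structures.
From mathcomp Require Import all_boot all_order all_algebra.
From mathcomp Require Import boolp classical_sets.
From mathcomp Require Import ring.

Set Implicit Arguments.
Unset Strict Implicit.
Unset Printing Implicit Defensive.

Import GRing.Theory Pdiv.Ring Pdiv.RingMonic.

Local Open Scope classical_set_scope.
Local Open Scope ring_scope.

(* The completeness axiom is convergence of p-adic Cauchy sequences, written
   for sequences with u_{n+1} = u_n mod p^n; separatedness follows from
   cdvr_valuation. *)
Record complete_dvr (R : idomainType) (p : R) : Prop := CompleteDVR {
  cdvr_neq0 : p != 0;
  cdvr_nonunit : p \isn't a GRing.unit;
  cdvr_valuation : forall a : R, a != 0 ->
    exists u n, u \is a GRing.unit /\ a = u * p ^+ n;
  cdvr_complete : forall u : nat -> R,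
    (forall n, exists c, u n.+1 - u n = c * p ^+ n) ->
    exists l, forall n, exists c, l - u n = c * p ^+ n }.

(* res exhibits k as R / pR. *)
Definition is_residue_map (R : idomainType) (p : R) (k : fieldType)
    (res : {rmorphism R -> k}) : Prop :=
  (forall c : k, exists a, res a = c) /\
  (forall a : R, res a = 0 <-> exists b, a = p * b).

Definition restrict (S T : nzRingType) (phi : {rmorphism S -> T})
  (M : lmodType T) : Type := M.
Arguments restrict {S T} phi M.

Section Restriction.
Variables (S T : nzRingType) (phi : {rmorphism S -> T}) (M : lmodType T).

Local Notation restrict := (restrict phi M).
HB.instance Definition _ := GRing.Zmodule.copy restrict M.

Definition restrict_scale (s : S) (u : restrict) : restrict :=
  phi s *: (u : M).

Fact restrict_scaleA a b u :
  restrict_scale a (restrict_scale b u) = restrict_scale (a * b) u.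
Proof. by rewrite /restrict_scale scalerA rmorphM. Qed.

Fact restrict_scale1 : left_id 1 restrict_scale.
Proof. by move=> u; rewrite /restrict_scale rmorph1 scale1r. Qed.

Fact restrict_scaleDr : right_distributive restrict_scale +%R.
Proof. by move=> a u v; rewrite /restrict_scale scalerDr. Qed.

Fact restrict_scaleDl u : {morph restrict_scale^~ u : a b / a + b}.
Proof. by move=> a b; rewrite /restrict_scale rmorphD scalerDl. Qed.

HB.instance Definition _ := GRing.Zmodule_isLmodule.Build S restrict
  restrict_scaleA restrict_scale1 restrict_scaleDr restrict_scaleDl.
End Restriction.

Definition overR (R : comNzRingType) (L : algType R) (M : lmodType L) :
  lmodType R := restrict (in_alg L) M.

(* The components are indexed by pp, p0, 0p, 00, in this order. *)
Definition Asharp (R : idomainType) : comAlgType R :=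
  ((R^o * R^o) * (R^o * R^o))%type.

Fact size2_polyE (T : nzRingType) (q : {poly T}) :
  (size q <= 2)%N -> q = (q`_0)%:P + q`_1 *: 'X.
Proof.
move=> sq; apply/polyP=> i; rewrite coefD coefC coefZ coefX.
case: i => [|[|i]] /=; rewrite ?mulr0 ?mulr1 ?addr0 ?add0r //.
by apply: nth_default; apply: leq_trans sq _.
Qed.

Fact monic_XXsubC (T : nzRingType) (c : T) : 'X * ('X - c%:P) \is monic.
Proof. by rewrite monicMl ?monicX ?monicXsubC. Qed.

Fact size_XXsubC (T : nzRingType) (c : T) : size ('X * ('X - c%:P)) = 3%N.
Proof.
by rewrite size_monicM ?monicX ?size_polyX ?size_XsubC //
           -size_poly_eq0 size_XsubC.
Qed.

Section KleinianRing.
Variables (R : idomainType) (p : R).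

Definition sx : Asharp R := ((p, p), (0, 0)).

Definition sy : Asharp R := ((p, 0), (p, 0)).

Definition sz : Asharp R := ((p, 0), (0, 0)).

(* [true] stands for the index p and [false] for the index 0. *)
Definition idem (a b : bool) : Asharp R :=
  (((a && b)%:R, (a && ~~ b)%:R), ((~~ a && b)%:R, (~~ a && ~~ b)%:R)).

Definition Kpred : {pred Asharp R} := fun a =>
  `[< exists r s t u : R, a = r%:A + s *: sx + t *: sy + u *: (sx * sy) >].

Definition Apred : {pred Asharp R} := fun a =>
  `[< exists2 b, b \in Kpred & exists r : R, a = b + r *: sz >].

Fact KpredP (a : Asharp R) : reflect
  (exists r s t u : R,
     a = ((r + s * p + t * p + u * (p * p), r + s * p), (r + t * p, r)))
  (a \in Kpred).
Proof.
apply: (iffP idP) => [/asboolP|] [r [s [t [u ->]]]].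
  exists r, s, t, u; congr ((_, _), (_, _)); rewrite /= /GRing.scale /=; ring.
apply/asboolP; exists r, s, t, u.
by congr ((_, _), (_, _)); rewrite /= /GRing.scale /=; ring.
Qed.

Fact ApredP (a : Asharp R) : reflect
  (exists r s t v : R, a = ((r + p * v, r + s * p), (r + t * p, r)))
  (a \in Apred).
Proof.
apply: (iffP idP) => [/asboolP|].
  move=> [b /KpredP[r [s [t [u ->]]]] [v ->]].
  exists r, s, t, (s + t + u * p + v).
  by congr ((_, _), (_, _)); rewrite /= /GRing.scale /=; ring.
move=> [r [s [t [v ->]]]]; apply/asboolP.
exists ((r + s * p + t * p, r + s * p), (r + t * p, r)).
  apply/KpredP; exists r, s, t, 0.
  by congr ((_, _), (_, _)); ring.
exists (v - s - t).
by congr ((_, _), (_, _)); rewrite /= /GRing.scale /=; ring.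
Qed.

Fact Kpred_closed : subalg_closed Kpred.
Proof.
split.
- by apply/KpredP; exists 1, 0, 0, 0; congr ((_, _), (_, _)); ring.
- move=> c _ _ /KpredP[r [s [t [u ->]]]] /KpredP[r' [s' [t' [u' ->]]]].
  apply/KpredP; exists (c * r + r'), (c * s + s'), (c * t + t'), (c * u + u').
  by congr ((_, _), (_, _)); rewrite /= /GRing.scale /=; ring.
move=> _ _ /KpredP[r [s [t [u ->]]]] /KpredP[r' [s' [t' [u' ->]]]].
apply/KpredP; exists (r * r'), (r * s' + s * r' + s * s' * p),
  (r * t' + t * r' + t * t' * p),
  (r * u' + u * r' + s * t' + t * s' + p * (s * u' + u * s')
   + p * (t * u' + u * t') + p ^+ 2 * u * u').
by congr ((_, _), (_, _)) => /=; ring.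
Qed.

Fact Apred_closed : subalg_closed Apred.
Proof.
split.
- by apply/ApredP; exists 1, 0, 0, 0; congr ((_, _), (_, _)); ring.
- move=> c _ _ /ApredP[r [s [t [u ->]]]] /ApredP[r' [s' [t' [u' ->]]]].
  apply/ApredP; exists (c * r + r'), (c * s + s'), (c * t + t'), (c * u + u').
  by congr ((_, _), (_, _)); rewrite /= /GRing.scale /=; ring.
move=> _ _ /ApredP[r [s [t [u ->]]]] /ApredP[r' [s' [t' [u' ->]]]].
apply/ApredP; exists (r * r'), (r * s' + s * r' + s * s' * p),
  (r * t' + t * r' + t * t' * p), (r * u' + u * r' + p * u * u').
by congr ((_, _), (_, _)) => /=; ring.
Qed.

Fact Kpred_sub a : a \in Kpred -> a \in Apred.
Proof.
by move=> Ka; apply/asboolP; exists a => //; exists 0; rewrite scale0r addr0.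
Qed.

HB.instance Definition _ := GRing.isSubalgClosed.Build R (Asharp R) Kpred
  Kpred_closed.
HB.instance Definition _ := GRing.isSubalgClosed.Build R (Asharp R) Apred
  Apred_closed.

Record Kring : Type := KRing { Kval : Asharp R; _ : Kval \in Kpred }.
HB.instance Definition _ := [isSub for Kval].
HB.instance Definition _ := [Choice of Kring by <:].
HB.instance Definition _ := [SubChoice_isSubComNzRing of Kring by <:].
HB.instance Definition _ := GRing.SubZmodule_isSubLmodule.Build R (Asharp R)
  Kpred Kring (GRing.subalg_closedZ Kpred_closed).
HB.instance Definition _ := [SubNzRing_SubLmodule_isSubLalgebra of Kring by <:].
HB.instance Definition _ := [SubLalgebra_isSubAlgebra of Kring by <:].

Record Aring : Type := ARing { Aval : Asharp R; _ : Aval \in Apred }.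
HB.instance Definition _ := [isSub for Aval].
HB.instance Definition _ := [Choice of Aring by <:].
HB.instance Definition _ := [SubChoice_isSubComNzRing of Aring by <:].
HB.instance Definition _ := GRing.SubZmodule_isSubLmodule.Build R (Asharp R)
  Apred Aring (GRing.subalg_closedZ Apred_closed).
HB.instance Definition _ := [SubNzRing_SubLmodule_isSubLalgebra of Aring by <:].
HB.instance Definition _ := [SubLalgebra_isSubAlgebra of Aring by <:].

Fact sx_inK : sx \in Kpred.
Proof. by apply/KpredP; exists 0, 1, 0, 0; congr ((_, _), (_, _)); ring. Qed.

Fact sy_inK : sy \in Kpred.
Proof. by apply/KpredP; exists 0, 0, 1, 0; congr ((_, _), (_, _)); ring. Qed.

Fact sz_inA : sz \in Apred.
Proof. by apply/ApredP; exists 0, 0, 0, 1; congr ((_, _), (_, _)); ring. Qed.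

Definition Kx : Kring := KRing sx_inK.

Definition Ky : Kring := KRing sy_inK.

(* Evaluation at (x, y) of polynomials in y with coefficients in R[x]. *)
Definition evK (g : {poly {poly R}}) : Asharp R :=
  (map_poly (horner_alg sx) g).[sy].

Fact evKE :
  evK = (fun g => horner_morph (fun a => mulrC sy (horner_alg sx a)) g).
Proof. by []. Qed.

Fact evKD g h : evK (g + h) = evK g + evK h.
Proof. by rewrite !evKE rmorphD. Qed.

Fact evKM g h : evK (g * h) = evK g * evK h.
Proof. by rewrite !evKE rmorphM. Qed.

Fact evKB g h : evK (g - h) = evK g - evK h.
Proof. by rewrite !evKE rmorphB. Qed.

Fact evKC c : evK c%:P = horner_alg sx c.
Proof. by rewrite evKE horner_morphC. Qed.

Fact evKX : evK 'X = sy.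
Proof. by rewrite evKE horner_morphX. Qed.

Fact horner_lin (r s : R) : horner_alg sx (r%:P + s *: 'X) = r%:A + s *: sx.
Proof.
by rewrite rmorphD -mul_polyC rmorphM /= !horner_algC horner_algX mulr_algl.
Qed.

Fact evK_X2 (r s t u : R) :
  evK ((r%:P + s *: 'X)%:P + (t%:P + u *: 'X)%:P * 'X) =
  r%:A + s *: sx + t *: sy + u *: (sx * sy).
Proof.
by rewrite evKD evKM !evKC evKX !horner_lin mulrDl mulr_algl -scalerAl addrA.
Qed.

Fact evK_rel (u v : {poly {poly R}}) :
  evK (u * ('X * ('X - p%:P))%:P + v * ('X * ('X - p%:P%:P))) = 0.
Proof.
have Hx : sx * (sx - p%:A) = 0.
  by congr ((_, _), (_, _)); rewrite /= /GRing.scale /=; ring.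
have Hy : sy * (sy - p%:A) = 0.
  by congr ((_, _), (_, _)); rewrite /= /GRing.scale /=; ring.
rewrite evKD !evKM evKB evKX !evKC rmorphM rmorphB /=.
rewrite horner_algX !horner_algC.
by rewrite Hx Hy !mulr0 addr0.
Qed.

Fact evK_reduce (g : {poly {poly R}}) :
  exists (u v : {poly {poly R}}) (r s t w : R),
  g = u * ('X * ('X - p%:P))%:P + v * ('X * ('X - p%:P%:P)) +
      ((r%:P + s *: 'X)%:P + (t%:P + w *: 'X)%:P * 'X).
Proof.
have red1 (h : {poly R}) : exists q r s,
    h = q * ('X * ('X - p%:P)) + (r%:P + s *: 'X).
  have mon := monic_XXsubC p.
  have := rdivp_eq mon h; set q := rdivp _ _; set e := rmodp _ _ => he.
  have se : (size e <= 2)%N.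
    by rewrite -ltnS -(size_XXsubC p) ltn_rmodp monic_neq0.
  by exists q, e`_0, e`_1; rewrite -size2_polyE.
have mon := monic_XXsubC p%:P.
have := rdivp_eq mon g; set q := rdivp _ _; set e := rmodp _ _ => he.
have se : (size e <= 2)%N.
  by rewrite -ltnS -(size_XXsubC p%:P) ltn_rmodp monic_neq0.
have [q0 [r [s e0]]] := red1 e`_0.
have [q1 [t [w e1]]] := red1 e`_1.
exists (q0%:P + q1%:P * 'X), q, r, s, t, w.
rewrite he {1}(size2_polyE se) -mul_polyC e0 e1 !polyCD !(polyCM _ ('X * _)).
by ring.
Qed.

(* Kring p is R[x,y] / (x(x - p), y(y - p)): the image of evaluation is K and
   its kernel is the ideal generated by the two relations. *)
Lemma Kring_image (a : Asharp R) : a \in Kpred <-> exists g, evK g = a.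
Proof.
split.
  by move=> /asboolP[r [s [t [u ->]]]]; eexists; apply: evK_X2.
move=> [g <-]; have [u [v [r [s [t [w ->]]]]]] := evK_reduce g.
apply/asboolP; exists r, s, t, w.
by rewrite -evK_X2 -[RHS]add0r -(evK_rel u v) -evKD.
Qed.

Lemma Kring_kernel (g : {poly {poly R}}) : p != 0 ->
  evK g = 0 <-> exists u v : {poly {poly R}},
    g = u * ('X * ('X - p%:P))%:P + v * ('X * ('X - p%:P%:P)).
Proof.
move=> p0; split; last by move=> [u [v ->]]; apply: evK_rel.
have [u [v [r [s [t [w ->]]]]]] := evK_reduce g.
rewrite evKD evK_rel add0r evK_X2 => /= -[e1 e2 e3 e4].
rewrite /GRing.scale /= in e1 e2 e3 e4.
have r0 : r = 0 by rewrite -e4; ring.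
have /eqP : s * p = 0 by rewrite -[RHS]e2 r0; ring.
rewrite mulf_eq0 (negPf p0) orbF => /eqP s0.
have /eqP : t * p = 0 by rewrite -[RHS]e3 r0; ring.
rewrite mulf_eq0 (negPf p0) orbF => /eqP t0.
have /eqP : w * (p * p) = 0 by rewrite -[RHS]e1 r0 s0 t0; ring.
rewrite !mulf_eq0 (negPf p0) !orbF => /eqP w0.
exists u, v.
by rewrite r0 s0 t0 w0 -!mul_polyC !(polyC0, mul0r, addr0).
Qed.

Definition KtoA (a : Kring) : Aring := ARing (Kpred_sub (valP a)).

Fact KtoA_is_zmod_morphism : zmod_morphism KtoA.
Proof.
move=> a b; apply: val_inj; rewrite rmorphB.
exact: (rmorphB (val : Kring -> Asharp R)).
Qed.

Fact KtoA_is_monoid_morphism : monoid_morphism KtoA.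
Proof. by split=> [|a b]; apply: val_inj; rewrite ?rmorph1 ?rmorphM. Qed.

HB.instance Definition _ := GRing.isZmodMorphism.Build Kring Aring KtoA
  KtoA_is_zmod_morphism.
HB.instance Definition _ := GRing.isMonoidMorphism.Build Kring Aring KtoA
  KtoA_is_monoid_morphism.

Definition AtoAsharp : {rmorphism Aring -> Asharp R} := val.

(* The homomorphism K -> R with x, y |-> p. *)
Definition Kaug (a : Kring) : R := (val a).1.1.

Fact Kaug_is_zmod_morphism : zmod_morphism Kaug.
Proof. by move=> a b; rewrite /Kaug rmorphB. Qed.

Fact Kaug_is_monoid_morphism : monoid_morphism Kaug.
Proof. by split=> [|a b]; rewrite /Kaug ?rmorph1 ?rmorphM. Qed.

HB.instance Definition _ := GRing.isZmodMorphism.Build Kring R Kaug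
  Kaug_is_zmod_morphism.
HB.instance Definition _ := GRing.isMonoidMorphism.Build Kring R Kaug
  Kaug_is_monoid_morphism.

Definition ax : Aring := ARing (Kpred_sub sx_inK).

Definition ay : Aring := ARing (Kpred_sub sy_inK).

Definition az : Aring := ARing sz_inA.

Fact KtoA_scalar (r : R) : KtoA r%:A = r%:A.
Proof.
apply: val_inj; rewrite [RHS]linearZ rmorph1.
have -> : val (KtoA r%:A) = val (r%:A : Kring) by [].
by rewrite linearZ rmorph1.
Qed.

End KleinianRing.

Section Lattices.
Variables (R : idomainType) (L : algType R).

(* Free of finite rank as an R-module. *)
Definition is_lattice (M : lmodType L) : Prop :=
  exists n (b : {linear 'rV[R]_n -> overR M}), bijective b.

Record lattice : Type := Lattice {
  lat_sort :> lmodType L;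
  latP : is_lattice lat_sort }.

Definition lmod_iso (M N : lmodType L) : Prop :=
  exists f : {linear M -> N}, bijective f.

Definition split_mono (M N : lmodType L) (f : {linear M -> N}) : Prop :=
  exists g : {linear N -> M}, cancel f g.

Definition split_epi (M N : lmodType L) (f : {linear M -> N}) : Prop :=
  exists g : {linear N -> M}, cancel g f.

Definition short_exact (M E N : lmodType L)
    (f : {linear M -> E}) (g : {linear E -> N}) : Prop :=
  [/\ injective f, forall w, exists v, g v = w &
      forall v, g v = 0 <-> exists u, v = f u].

Definition indecomposable (M : lattice) : Prop :=
  (exists u : M, u != 0) /\
  forall M1 M2 : lattice, lmod_iso M (M1 * M2)%type ->
    (forall u : M1, u = 0) \/ (forall u : M2, u = 0).

Definition irreducible_hom (M N : lattice) (f : {linear M -> N}) : Prop :=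
  [/\ ~ split_mono f, ~ split_epi f &
      forall (E : lattice) (g : {linear M -> E}) (h : {linear E -> N}),
        (forall u, f u = h (g u)) -> split_mono g \/ split_epi h].

Definition almost_split (M E N : lattice)
    (f : {linear M -> E}) (g : {linear E -> N}) : Prop :=
  [/\ indecomposable M, indecomposable N, short_exact f g, ~ split_epi g &
      forall (X : lattice) (h : {linear X -> N}), ~ split_epi h ->
        exists h' : {linear X -> E}, forall u, h u = g (h' u)].

(* M is (isomorphic to) the Auslander-Reiten translate of N. *)
Definition is_ar_translate (M N : lattice) : Prop :=
  exists (E : lattice) (f : {linear M -> E}) (g : {linear E -> N}),
    almost_split f g.

(* Isomorphism classes of M and N lie in the same connected component of the
   Auslander-Reiten quiver. *)
Inductive ar_connected : lattice -> lattice -> Prop :=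
| ArIso (M N : lattice) : lmod_iso M N -> ar_connected M N
| ArArrow (M N : lattice) (f : {linear M -> N}) :
    indecomposable M -> indecomposable N -> irreducible_hom f ->
    ar_connected M N
| ArSym (M N : lattice) : ar_connected M N -> ar_connected N M
| ArTrans (M N E : lattice) :
    ar_connected M N -> ar_connected N E -> ar_connected M E.

End Lattices.

Section AtoK.
Variables (R : idomainType) (p : R).

Fact overR_restrictE (M : lmodType (Aring p)) (r : R)
    (u : overR (restrict (@KtoA R p) M)) : r *: u = r *: (u : overR M).
Proof.
transitivity (KtoA (r%:A : Kring p) *: (u : M)); first by [].
by rewrite KtoA_scalar.
Qed.

Fact restrictK_is_lattice (M : lattice (Aring p)) :
  is_lattice (restrict (@KtoA R p) M).
Proof.
case: (latP M) => n [b bij_b]; exists n.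
have f_lin : linear (b : 'rV[R]_n -> overR (restrict (@KtoA R p) M)).
  by move=> r u v; rewrite overR_restrictE; apply: linearP.
pose bK := GRing.isLinear.Build _ _ _ _ _ f_lin.
exists (HB.pack_for {linear 'rV[R]_n -> overR (restrict (@KtoA R p) M)}
  (b : 'rV[R]_n -> overR (restrict (@KtoA R p) M)) bK).
exact: bij_b.
Qed.

Definition restrictK (M : lattice (Aring p)) : lattice (Kring p) :=
  Lattice (restrictK_is_lattice M).
End AtoK.

Record quiver_rep (k : fieldType) : Type := QuiverRep {
  vcent : nat;
  vdim : bool -> bool -> nat;
  vmap : forall a b, 'M[k]_(vdim a b, vcent) }.

Arguments vcent {k} V : rename.
Arguments vdim {k} V a b : rename.
Arguments vmap {k} V a b : rename.

(* q : V -> W exhibits W as the quotient Z / B, for submodules B of Z of V. *)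
Definition is_quotient (R : nzRingType) (V W : lmodType R) (Z B : set V)
    (q : V -> W) : Prop :=
  [/\ forall a u v, Z u -> Z v -> q (a *: u + v) = a *: q u + q v,
      forall w, exists2 u, Z u & q u = w &
      forall u, Z u -> (q u = 0 <-> B u)].

Section Phi.
Variables (R : idomainType) (p : R) (k : fieldType) (res : {rmorphism R -> k}).

(* j exhibits S as M# = A# M. *)
Definition is_sharp (M : lattice (Aring p)) (S : lattice (Asharp R))
    (j : {linear M -> restrict (@AtoAsharp R p) S}) : Prop :=
  injective j /\
  forall s : S, exists n (c : 'I_n -> Asharp R) (u : 'I_n -> M),
    s = \sum_i c i *: (j (u i) : S).

Definition weight_space (S : lattice (Asharp R)) (a b : bool) : set (overR S) :=
  [set s | sx p *: (s : S) = (if a then p else 0)%:A *: (s : S) /\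
           sy p *: (s : S) = (if b then p else 0)%:A *: (s : S)].

Definition mM (M : lattice (Aring p)) : set (overR M) :=
  [set u | exists u1 u2 u3 u4 : M,
     u = p%:A *: u1 + ax p *: u2 + ay p *: u3 + az p *: u4].

Definition is_Phi (M : lattice (Aring p)) (V : quiver_rep k) : Prop :=
  exists (S : lattice (Asharp R))
         (j : {linear M -> restrict (@AtoAsharp R p) S}),
  is_sharp j /\
  exists (qc : overR M -> restrict res 'cV[k]_(vcent V))
         (q : forall a b, overR S -> restrict res 'cV[k]_(vdim V a b)),
  [/\ is_quotient [set: overR M] (@mM M) qc,
      forall a b, is_quotient (@weight_space S a b)
        [set s | exists2 s', @weight_space S a b s' & s = p *: s'] (q a b) &
      forall a b u, q a b (idem R a b *: (j u : S)) = vmap V a b *m qc u].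

(* Rk M = (dc | d), with d true true = d_pp, d true false = d_p0, etc. *)
Definition Rk_is (M : lattice (Aring p)) (dc : nat) (d : bool -> bool -> nat) :
    Prop :=
  exists V : quiver_rep k,
    [/\ is_Phi M V, vcent V = dc & forall a b, vdim V a b = d a b].

(* T^f_1 for f of degree d. *)
Definition homogeneous_rep (f : {poly k}) : quiver_rep k :=
  let d := (size f).-1 in
  @QuiverRep k (d + d) (fun _ _ => d) (fun a b =>
    match a, b with
    | true, true => row_mx 1%:M 0
    | true, false => row_mx 0 1%:M
    | false, true => row_mx 1%:M 1%:M
    | false, false => row_mx 1%:M (companionmx f)
    end).

(* T m is T^f_m for m >= 1; T 0 is irrelevant. *)
Record is_homogeneous_tube (f : {poly k}) (T : nat -> lattice (Aring p)) :
    Prop := IsHomogeneousTube {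
  hom_indecomposable : forall m, (0 < m)%N -> indecomposable (T m);
  hom_component : forall N, indecomposable N ->
    (ar_connected (T 1) N <-> exists2 m, (0 < m)%N & lmod_iso (T m) N);
  hom_tau : forall m, (0 < m)%N ->
    is_ar_translate (restrictK (T m)) (restrictK (T m));
  hom_rank : forall m, (0 < m)%N ->
    let d := (size f).-1 in
    Rk_is (T m) (2 * d * m) (fun _ _ => d * m)%N;
  hom_first : is_Phi (T 1) (homogeneous_rep f);
  hom_ext_sub : forall m, (0 < m)%N ->
    exists (g : {linear T 1%N -> T m.+1}) (h : {linear T m.+1 -> T m}),
      short_exact g h;
  hom_ext_quo : forall m, (0 < m)%N ->
    exists (g : {linear T m -> T m.+1}) (h : {linear T m.+1 -> T 1%N}),
      short_exact g h }.

Inductive exceptional_index : Type := Lambda0 | Lambda1 | LambdaInf.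

(* Interchange d_p0 with d_00 for lambda = 0 and with d_0p for lambda = oo. *)
Definition swap_rank (lam : exceptional_index) (d : bool -> bool -> nat)
    (a b : bool) : nat :=
  match lam with
  | Lambda0 => d (if b then a else ~~ a) b
  | Lambda1 => d a b
  | LambdaInf => d b a
  end.

(* T i m is T^{lambda i}_m for i = 1, 2 and m >= 1, the other values are
   irrelevant; 3 - i is the element of {1, 2} other than i. *)
Record is_exceptional_tube (lam : exceptional_index)
    (T : nat -> nat -> lattice (Aring p)) : Prop := IsExceptionalTube {
  exc_indecomposable : forall i m, i \in [:: 1; 2]%N -> (0 < m)%N ->
    indecomposable (T i m);
  exc_component : forall N, indecomposable N ->
    (ar_connected (T 1 1) N <->
     exists i m, [/\ i \in [:: 1; 2]%N, (0 < m)%N & lmod_iso (T i m) N]);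
  exc_tau : forall i m, i \in [:: 1; 2]%N -> (0 < m)%N ->
    is_ar_translate (restrictK (T (3 - i)%N m)) (restrictK (T i m));
  exc_rank_even : forall i m, i \in [:: 1; 2]%N -> (0 < m)%N ->
    Rk_is (T i (2 * m)%N) (2 * m) (swap_rank lam (fun _ _ => m));
  exc_rank_odd1 : forall m, (0 < m)%N ->
    Rk_is (T 1 (2 * m - 1)%N) (2 * m - 1)
      (swap_rank lam (fun a _ => if a then m else m - 1)%N);
  exc_rank_odd2 : forall m, (0 < m)%N ->
    Rk_is (T 2 (2 * m - 1)%N) (2 * m - 1)
      (swap_rank lam (fun a _ => if a then m - 1 else m)%N);
  exc_mono : forall i m, i \in [:: 1; 2]%N -> (0 < m)%N ->
    let j := (if odd m then 3 - i else i)%N in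
    exists (g : {linear T i m -> T i m.+1}) (h : {linear T i m.+1 -> T j 1%N}),
      irreducible_hom g /\ short_exact g h;
  exc_epi : forall i m, i \in [:: 1; 2]%N -> (0 < m)%N ->
    exists (g : {linear T i 1%N -> T i m.+1})
           (h : {linear T i m.+1 -> T (3 - i)%N m}),
      irreducible_hom h /\ short_exact g h }.

End Phi.

(* A resolution of N by free modules of finite rank; elements of K^r are row
   vectors, on which the differentials act from the right. *)
Record free_resolution (S : nzRingType) (N : lmodType S) : Type :=
  FreeResolution {
  fr_rank : nat -> nat;
  fr_diff : forall n, 'M[S]_(fr_rank n.+1, fr_rank n);
  fr_aug : {linear 'rV[S]_(fr_rank 0) -> N};
  fr_aug_surj : forall v : N, exists u, fr_aug u = v;
  fr_exact0 : forall u, fr_aug u = 0 <-> exists v, u = v *m fr_diff 0;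
  fr_exact : forall n (u : 'rV[S]_(fr_rank n.+1)),
    u *m fr_diff n = 0 <-> exists v, u = v *m fr_diff n.+1 }.

(* The R-module sq_num / sq_den. *)
Record subquotient (R : nzRingType) : Type := Subquotient {
  sq_ambient : lmodType R;
  sq_num : set sq_ambient;
  sq_den : set sq_ambient }.

Definition sq_iso (R : nzRingType) (H : subquotient R) (W : lmodType R) :
    Prop :=
  exists q : sq_ambient H -> W, is_quotient (@sq_num R H) (@sq_den R H) q.

Section Cohomology.
Variables (R : comNzRingType) (S : comAlgType R) (N : lmodType S).
Variables (P : free_resolution N) (M : lmodType S).

(* Hom_S(S^r, M) and S^r (x) M are both identified with M^r, a homomorphism u
   with the values u(e_i) and a tensor sum_i e_i (x) u_i with (u_i); ext_diff
   and tor_diff are what the differential v |-> v *m D induces. *)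
Definition ext_diff (a b : nat) (D : 'M[S]_(a, b)) (u : {ffun 'I_b -> M}) :
  {ffun 'I_a -> M} := [ffun i => \sum_j D i j *: u j].

Definition tor_diff (a b : nat) (D : 'M[S]_(a, b)) (u : {ffun 'I_a -> M}) :
  {ffun 'I_b -> M} := [ffun j => \sum_i D i j *: u i].

Definition Ext (n : nat) : subquotient R :=
  @Subquotient R (overR {ffun 'I_(fr_rank P n) -> M})
    [set u | ext_diff (fr_diff P n) u = 0]
    (match n return set {ffun 'I_(fr_rank P n) -> M} with
     | 0 => [set 0]
     | n'.+1 => range (ext_diff (fr_diff P n'))
     end).

Definition Tor (n : nat) : subquotient R :=
  @Subquotient R (overR {ffun 'I_(fr_rank P n) -> M})
    (match n return set {ffun 'I_(fr_rank P n) -> M} with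
     | 0 => setT
     | n'.+1 => [set u | tor_diff (fr_diff P n') u = 0]
     end)
    (range (tor_diff (fr_diff P n))).

End Cohomology.

Section Tate.
Variables (R : idomainType) (p : R).

(* R as a K-module, with x and y acting as p. *)
Definition Rpp : lmodType (Kring p) := restrict (@Kaug R p) R^o.

Definition tate (P : free_resolution Rpp) (M : lmodType (Kring p)) (n : int) :
    subquotient R :=
  match n with
  | Posz 0 => @Subquotient R (overR M)
      [set u | Kx p *: (u : M) = p%:A *: (u : M) /\
               Ky p *: (u : M) = p%:A *: (u : M)]
      [set u | exists v : M, u = (Kx p * Ky p) *: v]
  | Posz n'.+1 => Ext P M n'.+1
  | Negz 0 => @Subquotient R (overR M)
      [set u | (Kx p * Ky p) *: (u : M) = 0]
      [set u | exists v w : M, u = (Kx p - p%:A) *: v + (Ky p - p%:A) *: w]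
  | Negz n'.+1 => Tor P M n'.+1
  end.

End Tate.

(* Main.v *)
From HB Require Import structures.
Require Import Defs.
From mathcomp Require Import all_boot all_order all_algebra.
From mathcomp Require Import boolp classical_sets.
From mathcomp Require Import ring.

(* Call a K-module M exact along y if the 2-periodic complex
   M -y-> M -(y - p)-> M -y-> ... is exact. This passes to extensions, and for
   T_1 it says that V -> V_pp + V_0p and V -> V_p0 + V_00 are bijective, which
   the given data show; hence every T_m is exact along y (along x for
   lambda = oo, where the roles of x and y are exchanged).

   An exact lattice is relatively projective over R[y]/(y(y - p)). Writing
   M' for M with x acting as p - x, there is an exact sequence
   0 -> Hom_K(-, M') -> Hom_{R[y]}(-, M) -> Hom_K(-, M) -> 0 on free K-modules,
   the second map being the relative trace h |-> x h + h (x - p), and the middle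
   term has no Tate cohomology. So H^n(M) = H^(n+1)(M'), H^n(M) depends only on
   the parity of n, and the two remaining groups H^0(M) and H^0(M') are read off
   as V_pp and V_0p. *)

(** The resolution [P] is arbitrary, so its differentials show no periodicity: this has to come from
    the pair M, M'. One shift argument serves all degrees because [P] is spliced with its transpose
    into a complete resolution. This is possible since K is a Frobenius algebra over R, the
    coefficient of xy being the form, and since K multiplies xy through the augmentation K -> R. The
    delicate point is the vanishing of cohomology for Hom_{R[y]}(-, M). It needs M to be a summand
    of R[y] (x)_R M over R[y], and it needs the complete resolution to split over R. Both rest on
    one fact: over a valuation ring the kernel of finitely many functionals on a finitely generated
    module is a summand. The relative trace comes from the dual bases 1, x and x - p, 1 of R[x]/(x(x
    - p)). Its kernel is Hom_K(-, M') because x h + h (x - p) = 0 says h x = (p - x) h. Degree -1 is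
    given by a formula of its own and is compared with H^0(M') directly, through multiplication by
    y. *)

Set Implicit Arguments.
Unset Strict Implicit.
Unset Printing Implicit Defensive.

Import GRing.Theory.

Local Open Scope ring_scope.

(** * Linear functions and splittings over a valuation ring *)

Section LinearFunctions.
Variables (R : nzRingType) (M N : lmodType R) (f : M -> N).
Hypothesis f_lin : linear f.

Lemma linear_fB u v : f (u - v) = f u - f v.
Proof. exact: zmod_morphism_linear. Qed.

Lemma linear_f0 : f 0 = 0.
Proof. by rewrite -(subrr 0) linear_fB subrr. Qed.

Lemma linear_fD u v : f (u + v) = f u + f v.
Proof. by rewrite -[u]scale1r f_lin !scale1r. Qed.

Lemma linear_fZ a u : f (a *: u) = a *: f u.
Proof. by rewrite -[a *: u]addr0 f_lin linear_f0 addr0. Qed.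

Lemma linear_f_sum (I : finType) (F : I -> M) :
  f (\sum_i F i) = \sum_i f (F i).
Proof. exact: (big_morph f linear_fD linear_f0). Qed.
End LinearFunctions.

(** * Isomorphisms of subquotients given by linear relations *)

Section Subquotients.
Variable R : nzRingType.

Definition sub_closed (V : lmodType R) (Z : set V) :=
  forall a u v, Z u -> Z v -> Z (a *: u + v).

(** A connecting homomorphism depends on a choice of lifts. The relation [rho] admits all lifts at
    once, so its linearity is immediate and choices enter only here. *)
Lemma sq_iso_correspondence (H H' : subquotient R) (W : lmodType R)
    (rho : sq_ambient H -> sq_ambient H' -> Prop) :
  sub_closed (@sq_num _ H) -> sub_closed (@sq_num _ H') ->
  (forall a u v u' v', rho u u' -> rho v v' ->
     rho (a *: u + v) (a *: u' + v')) ->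
  (forall u, sq_num u -> exists2 u', sq_num u' & rho u u') ->
  (forall u', sq_num u' -> exists2 u, sq_num u & rho u u') ->
  (forall u u', sq_num u -> sq_num u' -> rho u u' ->
     (sq_den u <-> sq_den u')) ->
  sq_iso H W -> sq_iso H' W.
Proof.
move=> cl cl' rlin tot tot' rden [q [qlin qsurj qker]].
have [u0 n0 _] := qsurj 0.
have [u0' n0' r0] := tot _ n0.
have num0 : sq_num (0 : sq_ambient H).
  by have := cl (-1) _ _ n0 n0; rewrite scaleN1r addNr.
have num0' : sq_num (0 : sq_ambient H').
  by have := cl' (-1) _ _ n0' n0'; rewrite scaleN1r addNr.
have rho0 : rho 0 0.
  by have := rlin (-1) _ _ _ _ r0 r0; rewrite !scaleN1r !addNr.
have q0 : q 0 = 0.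
  have := qlin (-1) _ _ n0 n0; rewrite scaleN1r addNr => ->.
  by rewrite scaleN1r addNr.
have den0' : sq_den (0 : sq_ambient H').
  by apply/(rden _ _ num0 num0' rho0)/(qker _ num0).
(* Two partners of the same [u'] differ by an element related to 0, hence by an element of the
   denominator. *)
have quniq u v u' : sq_num u -> sq_num v -> sq_num u' ->
    rho u u' -> rho v u' -> q u = q v.
  move=> nu nv nu' ru rv.
  have nd := cl (-1) _ _ nv nu.
  have rd := rlin (-1) _ _ _ _ rv ru.
  rewrite [_ *: u']scaleN1r addNr in rd.
  have : q (-1 *: v + u) = 0 by apply/qker => //; apply/(rden _ _ nd num0' rd).
  rewrite qlin // scaleN1r => /eqP; rewrite addrC subr_eq0 => /eqP //.
have ch u' : exists u, sq_num u' -> sq_num u /\ rho u u'.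
  have [nu'|nu'] := pselect (sq_num u'); last by exists 0.
  by have [u nu ru] := tot' _ nu'; exists u.
have [f fP] := choice ch.
exists (fun u' => q (f u')); split.
- move=> a u v nu nv.
  have [nfu rfu] := fP _ nu; have [nfv rfv] := fP _ nv.
  rewrite -qlin //.
  have nuv := cl' a _ _ nu nv.
  have [nf rf] := fP _ nuv.
  by apply: (quniq _ _ (a *: u + v)) => //; [exact: cl | exact: rlin].
- move=> w; have [u nu <-] := qsurj w.
  have [u' nu' ru] := tot _ nu; exists u' => //.
  by have [nf rf] := fP _ nu'; apply: (quniq _ _ u').
- move=> u' nu'; have [nf rf] := fP _ nu'.
  split; first by move=> /(qker _ nf) /(rden _ _ nf nu' rf).
  by move=> /(rden _ _ nf nu' rf) /(qker _ nf).
Qed.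
End Subquotients.

(** * Kernels of functionals as direct summands *)

Section Splitting.
Variable R : idomainType.
Hypothesis dvd_total : forall a b : R,
  (exists c, a = c * b) \/ (exists c, b = c * a).

Definition fin_gen (M : lmodType R) :=
  exists n (g : 'I_n -> M), forall m, exists c : 'I_n -> R,
    m = \sum_i c i *: g i.

Lemma fin_gen_finType (M : lmodType R) (I : finType) (g : I -> M) :
  (forall m, exists c : I -> R, m = \sum_i c i *: g i) -> fin_gen M.
Proof.
move=> gP; exists #|I|, (fun k => g (enum_val k)) => m.
have [c ->] := gP m; exists (fun k => c (enum_val k)).
by rewrite (reindex_onto enum_val enum_rank) /= => [|i _];
   rewrite ?enum_rankK //; apply: eq_bigl => k; rewrite enum_valK eqxx.
Qed.

Definition functional (M : lmodType R) (l : M -> R) :=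
  forall a u v, l (a *: u + v) = a * l u + l v.

Lemma functional0 (M : lmodType R) (l : M -> R) : functional l -> l 0 = 0.
Proof.
by move=> lP; have := lP (-1) 0 0; rewrite scaleN1r addNr mulN1r addNr.
Qed.

Lemma functionalD (M : lmodType R) (l : M -> R) u v :
  functional l -> l (u + v) = l u + l v.
Proof. by move=> lP; have := lP 1 u v; rewrite scale1r mul1r. Qed.

Lemma functionalZ (M : lmodType R) (l : M -> R) a u :
  functional l -> l (a *: u) = a * l u.
Proof. by move=> lP; have := lP a u 0; rewrite addr0 functional0 // addr0. Qed.

Lemma functional_sum (M : lmodType R) (l : M -> R) (I : finType) (F : I -> M) :
  functional l -> l (\sum_i F i) = \sum_i l (F i).
Proof.
move=> lP; apply: (big_morph l) => [u v|]; [exact: functionalD|].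
exact: functional0.
Qed.

(** Divisibility is total, so among the values of [l] at finitely many generators one divides all
    the others. *)
Lemma functional_generator (M : lmodType R) (l : M -> R) :
  fin_gen M -> functional l ->
  exists g, forall m, exists c, l m = c * l g.
Proof.
move=> [n [g gP]] lP.
have [g0 g0P] : exists g0, forall i, exists c, l (g i) = c * l g0.
  elim: n g {gP} => [|n IHn] g; first by exists 0 => -[].
  have [g0 g0P] := IHn (fun i => g (lift ord0 i)).
  have [[c cE]|[c cE]] := dvd_total (l g0) (l (g ord0)).
    exists (g ord0) => i; case: (unliftP ord0 i) => [j|] ->.
      by have [d ->] := g0P j; exists (d * c); rewrite -mulrA -cE.
    by exists 1; rewrite mul1r.
  exists g0 => i; case: (unliftP ord0 i) => [j|] -> //.
  by exists c.
have [d dP] := choice g0P.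
exists g0 => m; have [c ->] := gP m.
exists (\sum_i c i * d i); rewrite functional_sum // mulr_suml.
by apply: eq_bigr => i _; rewrite functionalZ // dP mulrA.
Qed.

(** The image of [l] is generated by [l g], hence zero or free of rank one; dividing by [l g] splits
    [l]. *)
Lemma functional_projector (M : lmodType R) (l : M -> R) :
  fin_gen M -> functional l ->
  exists e : M -> M, [/\ linear e, forall m, l (e m) = l m &
    forall m, l m = 0 -> e m = 0].
Proof.
move=> fgM lP; have [g gP] := functional_generator fgM lP.
have [g0|g0] := eqVneq (l g) 0.
  exists (fun=> 0); split=> // [a u v|m].
    by rewrite scaler0 addr0.
  by have [c ->] := gP m; rewrite g0 mulr0 functional0.
have [d dP] := choice gP.
have dl : forall a u v, d (a *: u + v) = a * d u + d v.
  move=> a u v; apply: (mulIf g0).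
  by rewrite mulrDl -mulrA -!dP lP.
exists (fun m => d m *: g); split.
- by move=> a u v; rewrite dl scalerDl scalerA.
- by move=> m; rewrite functionalZ // -dP.
- move=> m m0; have /eqP := dP m; rewrite m0 eq_sym mulf_eq0 (negPf g0) orbF.
  by move=> /eqP->; rewrite scale0r.
Qed.

(* Over a valuation ring the kernel of finitely many functionals on a finitely
   generated module is a direct summand; [e] is the projection along it. *)
Let nat_functionals_projector (M : lmodType R) (n : nat) (l : nat -> M -> R) :
  fin_gen M -> (forall i, functional (l i)) ->
  exists e : M -> M, [/\ linear e, forall i m, (i < n)%N -> l i (e m) = l i m &
    forall m, (forall i, (i < n)%N -> l i m = 0) -> e m = 0].
Proof.
move=> fgM; elim: n l => [|n IHn] l lP.
  by exists (fun=> 0); split=> // a u v; rewrite scaler0 addr0.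
have [e [elin le ke]] := functional_projector fgM (lP n).
have l'P i : functional (fun m => l i (m - e m)).
  move=> a u v; rewrite elin opprD addrACA -scalerBr; exact: lP.
have [e' [e'lin le' ke']] := IHn _ l'P.
have lB i u v : l i (u - v) = l i u - l i v.
  by rewrite functionalD // -scaleN1r functionalZ // mulN1r.
have eB u v : e (u - v) = e u - e v.
  exact: linear_fB.
have eid m : e (m - e m) = 0 by apply: ke; rewrite lB le subrr.
(* This is e + (1 - e) e' (1 - e). Since 1 - e maps into the kernel of [l n], the inductive
   projector corrects the other functionals without changing [l n]. *)
exists (fun m => e m + (e' (m - e m) - e (e' (m - e m)))); split.
- move=> a u v.
  have -> : a *: u + v - e (a *: u + v) = a *: (u - e u) + (v - e v).
    by rewrite elin scalerBr opprD addrACA.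
  rewrite elin e'lin elin opprD (addrACA (a *: e' _)) -scalerBr addrACA.
  by rewrite -scalerDr.
- move=> i m; rewrite ltnS leq_eqVlt => /orP[/eqP->|ltin].
    by rewrite functionalD // le lB le subrr addr0.
  by rewrite functionalD // le' // eid subr0 lB addrC subrK.
- move=> m m0; have em : e m = 0 by apply: ke; apply: m0.
  rewrite em subr0 add0r.
  have -> : e' m = 0.
    apply: ke' => i ltin; rewrite em subr0; apply: m0; exact: ltnW.
  by rewrite (linear_f0 elin) subr0.
Qed.

Lemma functionals_projector (M : lmodType R) (I : finType) (l : I -> M -> R) :
  fin_gen M -> (forall i, functional (l i)) ->
  exists e : M -> M, [/\ linear e, forall i m, l i (e m) = l i m &
    forall m, (forall i, l i m = 0) -> e m = 0].
Proof.
move=> fgM lP.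
pose l' j m := oapp (fun k : 'I_#|I| => l (enum_val k) m) 0 (insub j).
have l'E (k : 'I_#|I|) m : l' k m = l (enum_val k) m by rewrite /l' valK.
have l'P j : functional (l' j).
  rewrite /l'; case: (insub j) => [k|] a u v /=; first exact: lP.
  by rewrite mulr0 addr0.
have [e [elin le ke]] := nat_functionals_projector #|I| fgM l'P.
exists e; split=> // [i m|m m0].
  by have := le (enum_rank i) m (ltn_ord _); rewrite !l'E enum_rankK.
apply: ke => j ltj; exact: (etrans (l'E (Ordinal ltj) m) (m0 _)).
Qed.

(** The image of [phi] is the kernel of the functionals [l'] and the kernel of [phi] is that of the
    functionals [l i \o phi], so both are summands, and [phi] has an inner inverse. *)
Lemma regular_of_functionals (M N : lmodType R) (phi : M -> N)
    (I J : finType) (l : I -> N -> R) (l' : J -> N -> R) :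
  fin_gen M -> fin_gen N -> linear phi ->
  (forall i, functional (l i)) -> (forall i, functional (l' i)) ->
  (forall v, (forall i, l i v = 0) -> v = 0) ->
  (forall v, (exists u, v = phi u) <-> forall i, l' i v = 0) ->
  exists s : N -> M, linear s /\ forall u, phi (s (phi u)) = phi u.
Proof.
move=> fgM fgN plin lP l'P l0 l'E.
have [e [elin le ke]] := functionals_projector fgN l'P.
have lphiP i : functional (fun u => l i (phi u)).
  by move=> a u v; rewrite plin lP.
have [f [flin lf kf]] := functionals_projector fgM lphiP.
have im v : exists u, v - e v = phi u.
  apply/l'E => i; rewrite functionalD // -scaleN1r functionalZ //.
  by rewrite le mulN1r subrr.
have [w wP] := choice im.
have fB u v : f (u - v) = f u - f v.
  exact: linear_fB.
have phiB u v : phi (u - v) = phi u - phi v.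
  exact: linear_fB.
have feq u v : phi u = phi v -> f u = f v.
  move=> uv; apply/eqP; rewrite -subr_eq0 -fB; apply/eqP/kf => i.
  by rewrite phiB uv subrr functional0.
(* [w] is a mere choice of preimages, but [f] is constant on the fibres of [phi], which makes the
   composite linear. *)
exists (fun v => f (w v)); split.
  move=> a u v; rewrite -flin; apply: feq.
  by rewrite plin -!wP elin opprD addrACA -scalerBr.
move=> u.
have fphi v : phi (f v) = phi v.
  apply/eqP; rewrite -subr_eq0 -phiB; apply/eqP/l0 => i.
  rewrite phiB functionalD // lf -scaleN1r functionalZ // mulN1r.
  by rewrite subrr.
rewrite fphi -wP ke ?subr0 //.
exact: (proj1 (l'E (phi u)) (ex_intro _ u erefl)).
Qed.
End Splitting.

(** * The ring K *)

Section KleinianStructure.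
Variables (R : idomainType) (p : R).
Hypothesis p0 : p != 0.
Local Notation K := (Kring p).

Lemma Kval_inj (a b : K) : Kval a = Kval b -> a = b.
Proof. exact: val_inj. Qed.

Lemma KvalD (a b : K) : Kval (a + b) = Kval a + Kval b.
Proof. exact: (rmorphD (val : K -> Asharp R)). Qed.

Lemma KvalB (a b : K) : Kval (a - b) = Kval a - Kval b.
Proof. exact: (rmorphB (val : K -> Asharp R)). Qed.

Lemma KvalM (a b : K) : Kval (a * b) = Kval a * Kval b.
Proof. exact: (rmorphM (val : K -> Asharp R)). Qed.

Definition Kconst (r : R) : K := r%:A.

Local Notation "r %:K" := (Kconst r) (at level 1, format "r %:K").

Lemma Kval_const (r : R) : Kval r%:K = ((r, r), (r, r)).
Proof.
have -> : Kval r%:K = r *: 1.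
  have -> : Kval r%:K = val (r%:A : K) by [].
  by rewrite linearZ rmorph1.
by congr ((_, _), (_, _)); rewrite /= /GRing.scale /= mulr1.
Qed.

(* [gen true] = x and [gen false] = y, so that statements about K can be made
   for both orders of the two generators at once. *)
Definition gen (c : bool) : K := if c then Kx p else Ky p.

Lemma Kval_gen c : Kval (gen c) = if c then sx p else sy p.
Proof. by case: c. Qed.

Lemma KvalKx : Kval (Kx p) = sx p. Proof. by []. Qed.

Lemma KvalKy : Kval (Ky p) = sy p. Proof. by []. Qed.

Definition KvalE := (Kval_const, Kval_gen, KvalB, KvalD, KvalM).

Lemma gen_sqr c : gen c * gen c = p%:K * gen c.
Proof.
apply: Kval_inj; rewrite !KvalE.
by case: c; congr ((_, _), (_, _)); rewrite /=; ring.
Qed.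

Lemma gen_span c (a : K) : exists r s t u : R,
  a = r%:K + s%:K * gen c + t%:K * gen (~~ c)
    + u%:K * (gen c * gen (~~ c)).
Proof.
have /KpredP[r [s [t [u aE]]]] : Kval a \in Kpred p := valP a.
exists r, (if c then s else t), (if c then t else s), u.
apply: Kval_inj; rewrite aE !KvalE.
by case: c; congr ((_, _), (_, _)); rewrite /=; ring.
Qed.

(** Exchanges the components where [gen c] is p with those where it is 0. Restricted to K this is
    the automorphism by which M is twisted into M'. *)
Definition sharp_flip (c : bool) (a : Asharp R) : Asharp R :=
  if c then (a.2, a.1) else ((a.1.2, a.1.1), (a.2.2, a.2.1)).

Fact sharp_flip_in c (a : K) : sharp_flip c (Kval a) \in Kpred p.
Proof.
have /KpredP[r [s [t [u ->]]]] : Kval a \in Kpred p := valP a; apply/KpredP.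
by case: c; [exists (r + s * p), (- s), (t + u * p), (- u)
           | exists (r + t * p), (s + u * p), (- t), (- u)];
   congr ((_, _), (_, _)); rewrite /=; ring.
Qed.

Definition flip c (a : K) : K := KRing (sharp_flip_in c a).

Lemma Kval_flip c (a : K) : Kval (flip c a) = sharp_flip c (Kval a).
Proof. by []. Qed.

Fact flip_is_zmod_morphism c : zmod_morphism (flip c).
Proof.
move=> a b; apply: Kval_inj; rewrite KvalB !Kval_flip KvalB.
by case: c.
Qed.

Fact flip_is_monoid_morphism c : monoid_morphism (flip c).
Proof.
split=> [|a b]; apply: Kval_inj; first by case: c.
by rewrite KvalM !Kval_flip KvalM; case: c.
Qed.

HB.instance Definition _ c := GRing.isZmodMorphism.Build K K (flip c)
  (flip_is_zmod_morphism c).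
HB.instance Definition _ c := GRing.isMonoidMorphism.Build K K (flip c)
  (flip_is_monoid_morphism c).

Lemma flip_const c (r : R) : flip c r%:K = r%:K.
Proof. by apply: Kval_inj; rewrite !(Kval_flip, KvalE); case: c. Qed.

Lemma flip_gen c : flip c (gen c) = p%:K - gen c.
Proof.
apply: Kval_inj; rewrite Kval_flip !KvalE.
by case: c; congr ((_, _), (_, _)); rewrite /=; ring.
Qed.

Lemma flip_genC c : flip c (gen (~~ c)) = gen (~~ c).
Proof. by apply: Kval_inj; rewrite !(Kval_flip, KvalE); case: c. Qed.

Lemma flip_genB c : flip c (gen c - p%:K) = - gen c.
Proof.
rewrite (rmorphB (flip c : {rmorphism K -> K})) /= flip_gen flip_const.
by rewrite addrAC subrr sub0r.
Qed.

Lemma flipK c : involutive (flip c).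
Proof.
move=> a; apply: Kval_inj; rewrite !Kval_flip; case: (Kval a) => [[? ?] [? ?]].
by case: c.
Qed.

Lemma Kconst_inj (a b : K) : p%:K * a = p%:K * b -> a = b.
Proof.
move=> /(congr1 (@Kval _ _)); rewrite !KvalE => ab; apply: Kval_inj.
case: (Kval a) (Kval b) ab => [[a1 a2] [a3 a4]] [[b1 b2] [b3 b4]].
by move=> [] /(mulfI p0)-> /(mulfI p0)-> /(mulfI p0)-> /(mulfI p0)->.
Qed.

(** Substitution of p (for [e = true]) or 0 for [gen c]. The difference of the two values, divided
    by p, is the coefficient of [gen c]. *)
Definition sharp_eval (c e : bool) (a : Asharp R) : Asharp R :=
  if c then if e then (a.1, a.1) else (a.2, a.2)
  else if e then ((a.1.1, a.1.1), (a.2.1, a.2.1))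
       else ((a.1.2, a.1.2), (a.2.2, a.2.2)).

(* [phi] is the coefficient of x in K = R[y] + x R[y] (for c = true). *)
Lemma ex_relative_trace1 c : exists phi : K -> K,
  [/\ forall a b, phi (a + b) = phi a + phi b,
      forall r a, phi (r%:K * a) = r%:K * phi a,
      forall a, phi (gen (~~ c) * a) = gen (~~ c) * phi a &
      forall a, gen c * phi a + phi ((gen c - p%:K) * a) = a].
Proof.
have ex (a : K) : exists b : K, Kval (p%:K * b) =
    sharp_eval c true (Kval a) - sharp_eval c false (Kval a).
  have [r [s [t [u ->]]]] := gen_span c a.
  exists (s%:K + u%:K * gen (~~ c)).
  rewrite !KvalE.
  by case: c; congr ((_, _), (_, _)); rewrite /=; ring.
have [phi phiP] := choice ex; exists phi.
have inj (a b : K) : Kval (p%:K * a) = Kval (p%:K * b) -> a = b.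
  by move=> /Kval_inj/Kconst_inj.
split=> [a b|r a|a|a]; apply: inj.
- rewrite mulrDr KvalD !phiP KvalD.
  case: (Kval a) (Kval b) => [[a1 a2] [a3 a4]] [[b1 b2] [b3 b4]].
  by case: c {ex phi phiP}; congr ((_, _), (_, _)); rewrite /=; ring.
- rewrite phiP (mulrCA p%:K) [RHS]KvalM (phiP a) KvalM Kval_const.
  case: (Kval a) => [[a1 a2] [a3 a4]].
  by case: c {ex phi phiP}; congr ((_, _), (_, _)); rewrite /=; ring.
- rewrite phiP (mulrCA p%:K) [RHS]KvalM (phiP a) KvalM Kval_gen.
  case: (Kval a) => [[a1 a2] [a3 a4]].
  by case: c {ex phi phiP}; congr ((_, _), (_, _)); rewrite /=; ring.
- rewrite mulrDr mulrCA KvalD (KvalM (gen c)) !phiP.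
  rewrite !KvalE.
  case: (Kval a) => [[a1 a2] [a3 a4]].
  by case: c {ex phi phiP}; congr ((_, _), (_, _)); rewrite /=; ring.
Qed.

Definition Kbasis (e : bool * bool) : K :=
  (if e.1 then Kx p else 1) * (if e.2 then Ky p else 1).

(** The basis dual to [Kbasis] when a, b are paired to the coefficient of xy in ab. In one variable
    t with t(t - p) = 0, the dual of 1 is t - p and the dual of t is 1. *)
Definition Kdual (e : bool * bool) : K :=
  (if e.1 then 1 else Kx p - p%:K) * (if e.2 then 1 else Ky p - p%:K).

(* [lam] is the coefficient of xy, a Frobenius form on K. *)
Lemma ex_Frobenius_form : exists lam : K -> R,
  [/\ forall r a b, lam (r%:K * a + b) = r * lam a + lam b,
      forall a, a = \sum_e (lam (a * Kdual e))%:K * Kbasis e &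
      lam (Kx p * Ky p) = 1].
Proof.
(* The coefficient of xy is the mixed second divided difference of the four coordinates. *)
have ex (a : K) : exists u : R, p * p * u =
    (Kval a).1.1 - (Kval a).1.2 - (Kval a).2.1 + (Kval a).2.2.
  have /KpredP[r [s [t [u ->]]]] : Kval a \in Kpred p := valP a.
  by exists u => /=; ring.
have [lam lamP] := choice ex; exists lam.
have pp0 : p * p != 0 by rewrite mulf_neq0.
have lamE (a : K) u : p * p * u =
    (Kval a).1.1 - (Kval a).1.2 - (Kval a).2.1 + (Kval a).2.2 -> lam a = u.
  by rewrite -lamP => /(mulfI pp0).
split.
- move=> r a b; apply: (mulfI pp0); rewrite mulrDr mulrCA !lamP !KvalE.
  case: (Kval a) (Kval b) => [[a1 a2] [a3 a4]] [[b1 b2] [b3 b4]] /=; ring.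
- move=> a; have [r [s [t [u ->]]]] := gen_span true a.
  rewrite -(pair_bigA _
    (fun c d => (lam (_ * Kdual (c, d)))%:K * Kbasis (c, d))).
  rewrite !big_bool /= /Kdual /Kbasis /= !mulr1 !mul1r.
  have l11 : lam (r%:K + s%:K * Kx p + t%:K * Ky p + u%:K * (Kx p * Ky p)) = u.
    by apply: lamE; rewrite !(KvalKx, KvalKy, KvalE) /=; ring.
  have l10 : lam ((r%:K + s%:K * Kx p + t%:K * Ky p + u%:K * (Kx p * Ky p))
      * (Ky p - p%:K)) = s.
    by apply: lamE; rewrite !(KvalKx, KvalKy, KvalE) /=; ring.
  have l01 : lam ((r%:K + s%:K * Kx p + t%:K * Ky p + u%:K * (Kx p * Ky p))
      * (Kx p - p%:K)) = t.
    by apply: lamE; rewrite !(KvalKx, KvalKy, KvalE) /=; ring.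
  have l00 : lam ((r%:K + s%:K * Kx p + t%:K * Ky p + u%:K * (Kx p * Ky p))
      * ((Kx p - p%:K) * (Ky p - p%:K))) = r.
    by apply: lamE; rewrite !(KvalKx, KvalKy, KvalE) /=; ring.
  by rewrite l11 l10 l01 l00; ring.
- by apply: lamE; rewrite !(KvalKx, KvalKy, KvalE) /=; ring.
Qed.

End KleinianStructure.

(** * Dimension shifting *)

Section DimensionShift.
Variables (R : idomainType) (p : R).
Hypothesis p0 : p != 0.
Local Notation K := (Kring p).
Local Notation gen := (gen p).
Local Notation "r %:K" := (Kconst p r) (at level 1, format "r %:K").

Definition Rlinear (M N : lmodType K) (f : M -> N) :=
  linear (f : overR M -> overR N).

(** Linearity over R[[gen (~~ c)]]: such maps form the middle term of the exact sequence. *)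
Definition Klinear_but (c : bool) (M N : lmodType K) (f : M -> N) :=
  Rlinear f /\ forall u, f (gen (~~ c) *: u) = gen (~~ c) *: f u.

Section RlinearTheory.
Variables (M N : lmodType K) (f : M -> N).
Hypothesis f_lin : Rlinear f.

Lemma Rlinear0 : f 0 = 0. Proof. exact: (linear_f0 f_lin). Qed.

Lemma RlinearD u v : f (u + v) = f u + f v.
Proof. exact: (linear_fD f_lin). Qed.

Lemma RlinearB u v : f (u - v) = f u - f v.
Proof. exact: (linear_fB f_lin). Qed.

Lemma RlinearZ r u : f (r%:K *: u) = r%:K *: f u.
Proof. exact: (linear_fZ f_lin). Qed.

Lemma Rlinear_sum (I : finType) (F : I -> M) :
  f (\sum_i F i) = \sum_i f (F i).
Proof. exact: (linear_f_sum f_lin). Qed.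
End RlinearTheory.

Lemma RlinearP (M N : lmodType K) (f : M -> N) :
  (forall u v, f (u + v) = f u + f v) ->
  (forall r u, f (r%:K *: u) = r%:K *: f u) -> Rlinear f.
Proof.
move=> fD fZ r u v; rewrite fD; congr (_ + _); exact: fZ.
Qed.

Lemma Rlinear_comp (M N L : lmodType K) (f : N -> L) (g : M -> N) :
  Rlinear f -> Rlinear g -> Rlinear (f \o g).
Proof. by move=> fl gl r u v /=; rewrite gl fl. Qed.

Lemma linear_Rlinear (M N : lmodType K) (f : M -> N) : linear f -> Rlinear f.
Proof.
move=> fl; apply: RlinearP => [u v|r u]; first exact: linear_fD.
exact: linear_fZ.
Qed.

Lemma linear_gen (M N : lmodType K) c (f : M -> N) :
  Klinear_but c f -> (forall u, f (gen c *: u) = gen c *: f u) -> linear f.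
Proof.
move=> [fR fy] fx a u v; rewrite (RlinearD fR); congr (_ + _).
have [r [s [t [w ->]]]] := gen_span c a.
by rewrite !scalerDl -!scalerA !(RlinearD fR, RlinearZ fR, fx, fy).
Qed.

Definition row_hom (M : lmodType K) b (u : {ffun 'I_b -> M}) (v : 'rV[K]_b) :=
  \sum_j v 0 j *: u j.

Lemma row_hom_linear (M : lmodType K) b (u : {ffun 'I_b -> M}) :
  linear (row_hom u).
Proof.
move=> a v w; rewrite /row_hom scaler_sumr -big_split; apply: eq_bigr => j _ /=.
by rewrite !mxE scalerDl scalerA.
Qed.

Lemma row_hom_delta (M : lmodType K) b (u : {ffun 'I_b -> M}) j :
  row_hom u (delta_mx 0 j) = u j.
Proof.
rewrite /row_hom (bigD1 j) //= mxE !eqxx scale1r big1 ?addr0 // => i ij.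
by rewrite mxE (negPf ij) andbF scale0r.
Qed.

Lemma row_homE (M : lmodType K) b (h : 'rV[K]_b -> M) : linear h ->
  h =1 row_hom [ffun j => h (delta_mx 0 j)].
Proof.
move=> hl v; rewrite [in LHS](row_sum_delta v) (linear_f_sum hl).
by apply: eq_bigr => j _; rewrite ffunE (linear_fZ hl).
Qed.

Lemma row_hom_inj (M : lmodType K) b (u w : {ffun 'I_b -> M}) :
  row_hom u =1 row_hom w -> u = w.
Proof. by move=> uw; apply/ffunP => j; rewrite -!row_hom_delta uw. Qed.

Lemma row_hom_lincomb (M : lmodType K) b (a : R)
    (u w : overR {ffun 'I_b -> M}) v :
  row_hom (a *: u + w) v = a%:K *: row_hom u v + row_hom w v.
Proof.
rewrite /row_hom scaler_sumr -big_split; apply: eq_bigr => j _ /=.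
have -> : (a *: u + w) j = a%:K *: (u : {ffun 'I_b -> M}) j + w j.
  by rewrite ffunE; congr (_ + _); rewrite ffunE.
by rewrite scalerDr !scalerA mulrC.
Qed.

Lemma row_hom_diff (M : lmodType K) a b (D : 'M[K]_(a, b))
    (u : {ffun 'I_b -> M}) v :
  row_hom (ext_diff D u) v = row_hom u (v *m D).
Proof.
rewrite /row_hom; under eq_bigr => j _ do rewrite ffunE scaler_sumr.
rewrite exchange_big; apply: eq_bigr => j _ /=.
by rewrite mxE scaler_suml; apply: eq_bigr => i _; rewrite scalerA.
Qed.

Lemma ext_diff_lincomb (M : lmodType K) a b (D : 'M[K]_(a, b)) (r : R)
    (u w : overR {ffun 'I_b -> M}) :
  ext_diff D (r *: u + w) =
    r *: (ext_diff D u : overR {ffun 'I_a -> M}) + ext_diff D w.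
Proof.
apply: row_hom_inj => v.
by rewrite row_hom_lincomb !row_hom_diff row_hom_lincomb.
Qed.

Definition exact_at a b d (D1 : 'M[K]_(a, b)) (D2 : 'M[K]_(b, d)) :=
  forall u : 'rV_b, u *m D2 = 0 <-> exists v, u = v *m D1.

(** The inner inverse [s] is only R-linear; it serves to extend R-linear maps that vanish on the
    kernel of [D]. *)
Definition regular a b (D : 'M[K]_(a, b)) :=
  exists2 s : 'rV[K]_b -> 'rV[K]_a, Rlinear s &
    forall v, s (v *m D) *m D = v *m D.

(* The cohomology at Hom(K^b, M) of the complex obtained by applying
   Hom(-, M) to K^a -> K^b -> K^d. *)
Definition hom_homology a b d (D1 : 'M[K]_(a, b)) (D2 : 'M[K]_(b, d))
    (M : lmodType K) : subquotient R :=
  @Subquotient R (overR {ffun 'I_b -> M})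
    [set u | ext_diff D1 u = 0]%classic (range (ext_diff D2 (M := M))).

Lemma hom_homology_closed a b d (D1 : 'M[K]_(a, b)) (D2 : 'M[K]_(b, d))
    (M : lmodType K) : sub_closed (@sq_num _ (hom_homology D1 D2 M)).
Proof.
move=> r u v /= u0 v0; rewrite ext_diff_lincomb u0 v0.
by rewrite scaler0 addr0.
Qed.

(* [beta] makes the multiplication K_c (x)_R M -> M, with K_c = R[gen c], a
   split epimorphism of K_c-modules, by m |-> gen c (x) beta m
   + 1 (x) beta ((gen c - p) m). *)
Definition relatively_projective c (M : lmodType K) :=
  exists2 beta : M -> M, Rlinear beta &
    forall m, gen c *: beta m + beta ((gen c - p%:K) *: m) = m.

(** The sum of e h(e' m) over the dual bases e = [gen c], 1 and e' = 1, [gen c - p]; as for every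
    Casimir sum, the result commutes with [gen c]. *)
Definition rel_trace c (M N : lmodType K) (h : M -> N) m :=
  gen c *: h m + h ((gen c - p%:K) *: m).

Lemma rel_trace_Rlinear c (M N : lmodType K) (h : M -> N) :
  Rlinear h -> Rlinear (rel_trace c h).
Proof.
move=> hl; apply: RlinearP => [u v|r u].
  by rewrite /rel_trace !scalerDr !(RlinearD hl) scalerDr addrACA.
rewrite /rel_trace (RlinearZ hl) !(scalerA _ r%:K) ![_ * r%:K]mulrC -!scalerA.
by rewrite (RlinearZ hl) scalerDr.
Qed.

Lemma rel_trace_gen c (M N : lmodType K) (h : M -> N) u :
  Rlinear h -> rel_trace c h (gen c *: u) = gen c *: rel_trace c h u.
Proof.
move=> hl; rewrite /rel_trace scalerDr !scalerA gen_sqr mulrBl gen_sqr subrr.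
rewrite scale0r (Rlinear0 hl) addr0 !scalerBl (RlinearB hl) (RlinearZ hl).
by rewrite scalerBr scalerA [gen c * _]mulrC addrC subrK.
Qed.

Lemma rel_trace_genC c (M N : lmodType K) (h : M -> N) u :
  Klinear_but c h ->
  rel_trace c h (gen (~~ c) *: u) = gen (~~ c) *: rel_trace c h u.
Proof.
move=> [hl hy]; rewrite /rel_trace (scalerA (_ - _)) [(_ - _) * _]mulrC.
by rewrite -scalerA !hy scalerDr !scalerA [gen c * _]mulrC.
Qed.

Lemma rel_trace_linear c (M N : lmodType K) (h : M -> N) :
  Klinear_but c h -> linear (rel_trace c h).
Proof.
move=> hP; apply: (@linear_gen _ _ c).
  split; [by case: hP => hl _; exact: rel_trace_Rlinear|].
  by move=> u; exact: rel_trace_genC.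
by move=> u; case: hP => hl _; exact: rel_trace_gen.
Qed.

Lemma factor_Rlinear a b (D : 'M[K]_(a, b)) (M : lmodType K)
    (f : 'rV[K]_a -> M) (s : 'rV[K]_b -> 'rV[K]_a) :
  Rlinear f -> (forall v, v *m D = 0 -> f v = 0) ->
  (forall v, s (v *m D) *m D = v *m D) ->
  forall v, f (s (v *m D)) = f v.
Proof.
move=> fl f0 sP v; apply/eqP; rewrite -subr_eq0 -(RlinearB fl).
by apply/eqP/f0; rewrite mulmxBl sP subrr.
Qed.

(** This is the acyclicity of the middle term. The inner inverse of [D] extends [beta \o f]
    R-linearly, and the trace along [gen (~~ c)] turns the extension of [beta \o f] into one of
    [f]. *)
Lemma relatively_projective_factor c a b (D : 'M[K]_(a, b)) (M : lmodType K)
    (f : 'rV[K]_a -> M) :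
  relatively_projective (~~ c) M -> regular D ->
  Klinear_but c f -> (forall v, v *m D = 0 -> f v = 0) ->
  exists2 h : 'rV[K]_b -> M, Klinear_but c h & forall v, h (v *m D) = f v.
Proof.
move=> [beta bl bP] [s sl sP] [fl fy] f0.
pose g v := beta (f (s v)).
have gl : Rlinear g.
  exact: (Rlinear_comp bl (Rlinear_comp fl sl)).
have gD v : g (v *m D) = beta (f v) by rewrite /g (factor_Rlinear fl f0 sP).
exists (rel_trace (~~ c) g).
  by split=> [|u]; [exact: rel_trace_Rlinear | exact: rel_trace_gen].
move=> v; rewrite /rel_trace scalemxAl !gD.
by rewrite scalerBl (RlinearB fl) fy (RlinearZ fl) -scalerBl bP.
Qed.

(** Composing with [phi] exhibits every K-linear map out of a free module as a relative trace: the
    exact sequence is exact on the right. *)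
Lemma ex_row_trace1 c b : exists2 phi : 'rV[K]_b -> 'rV[K]_b,
  Klinear_but c phi & forall v, rel_trace c phi v = v.
Proof.
have [phi [phiD phiZ phiy phi1]] := ex_relative_trace1 p0 c.
exists (map_mx phi).
  split.
    by apply: RlinearP => [u v|r u]; apply/rowP => j; rewrite !mxE ?phiD ?phiZ.
  by move=> u; apply/rowP => j; rewrite !mxE phiy.
by move=> v; apply/rowP => j; rewrite !mxE phi1.
Qed.

(** * The connecting isomorphism *)

Section Shift.
Variables (c : bool) (M1 M2 : lmodType K) (tau : M1 -> M2) (tau' : M2 -> M1).
Hypotheses (tauK : cancel tau tau') (tau'K : cancel tau' tau).
Hypothesis tauD : forall u v, tau (u + v) = tau u + tau v.
Hypothesis tauZ : forall a u, tau (a *: u) = flip c a *: tau u.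
Hypothesis proj2 : relatively_projective (~~ c) M2.

Lemma twist_Klinear_but b (f : 'rV[K]_b -> M1) :
  linear f -> Klinear_but c (tau \o f).
Proof.
move=> fl; split.
  apply: RlinearP => [u v|r u] /=; first by rewrite (linear_fD fl) tauD.
  by rewrite (linear_fZ fl) tauZ flip_const.
by move=> u /=; rewrite (linear_fZ fl) tauZ flip_genC.
Qed.

Lemma twist_rel_trace b (f : 'rV[K]_b -> M1) v :
  linear f -> rel_trace c (tau \o f) v = 0.
Proof.
move=> fl; rewrite /rel_trace /= (linear_fZ fl) tauZ flip_genB.
by rewrite scaleNr subrr.
Qed.

(** A vanishing trace says that [h] turns [gen c] into p - [gen c], which is linearity into the
    twisted module. *)
Lemma untwist_linear b (h : 'rV[K]_b -> M2) :
  Klinear_but c h -> (forall v, rel_trace c h v = 0) -> linear (tau' \o h).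
Proof.
move=> [hl hy] h0.
have tau_inj : injective tau by exact: can_inj tauK.
apply: (@linear_gen _ _ c).
  split.
    apply: RlinearP => [u v|r u] /=; apply: tau_inj.
      by rewrite tauD !tau'K (RlinearD hl).
    by rewrite tauZ !tau'K flip_const (RlinearZ hl).
  by move=> u /=; apply: tau_inj; rewrite tauZ !tau'K flip_genC hy.
move=> u /=; apply: tau_inj; rewrite tauZ !tau'K flip_gen.
have := h0 u; rewrite /rel_trace !scalerBl (RlinearB hl) (RlinearZ hl).
by move=> /eqP; rewrite addrCA addr_eq0 opprB => /eqP.
Qed.

Variables (a b d e : nat) (D1 : 'M[K]_(a, b)) (D2 : 'M[K]_(b, d)).
Variable D3 : 'M[K]_(d, e).
Hypotheses (ex12 : exact_at D1 D2) (ex23 : exact_at D2 D3).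
Hypotheses (reg2 : regular D2) (reg3 : regular D3).

(** The zigzag of the snake lemma: [h] lifts [u2] along the trace, and its composite with [D2] comes
    from [u1]. *)
Let rho (u1 : overR {ffun 'I_b -> M1}) (u2 : overR {ffun 'I_d -> M2}) :=
  exists h : 'rV[K]_d -> M2, [/\ Klinear_but c h,
    forall v, rel_trace c h v = row_hom u2 v &
    forall v, h (v *m D2) = tau (row_hom u1 v)].

Let rho_lin r u1 w1 u2 w2 :
  rho u1 u2 -> rho w1 w2 -> rho (r *: u1 + w1) (r *: u2 + w2).
Proof.
move=> [h [[hl hy] hT hD]] [k [[kl ky] kT kD]].
exists (fun v => r%:K *: h v + k v); split; [split|..].
- apply: RlinearP => [u v|s u].
    by rewrite (RlinearD hl) (RlinearD kl) scalerDr addrACA.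
  by rewrite (RlinearZ hl) (RlinearZ kl) scalerDr !scalerA mulrC.
- by move=> u; rewrite hy ky scalerDr !scalerA mulrC.
- move=> v; rewrite row_hom_lincomb -hT -kT /rel_trace !scalerDr !scalerA.
  by rewrite [gen c * _]mulrC addrACA.
- by move=> v; rewrite hD kD row_hom_lincomb tauD tauZ flip_const.
Qed.

Let D12 (v : 'rV_a) : v *m D1 *m D2 = 0.
Proof. by have [_] := ex12 (v *m D1); apply; exists v. Qed.

Let D23 (v : 'rV_b) : v *m D2 *m D3 = 0.
Proof. by have [_] := ex23 (v *m D2); apply; exists v. Qed.

Let tau0 : tau 0 = 0.
Proof. by have := tauD 0 0; rewrite addr0 -{1}[tau 0]addr0 => /addrI. Qed.

Let num_row_hom x y z (E1 : 'M[K]_(x, y)) (E2 : 'M[K]_(y, z)) (M : lmodType K)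
    (u : {ffun 'I_y -> M}) :
  sq_num (u : sq_ambient (hom_homology E1 E2 M)) <->
  forall v, row_hom u (v *m E1) = 0.
Proof.
split=> [/= u0 v|u0 /=].
  by rewrite -row_hom_diff u0 /row_hom big1 // => j _; rewrite ffunE scaler0.
apply: row_hom_inj => v; rewrite row_hom_diff u0 /row_hom big1 // => j _.
by rewrite ffunE scaler0.
Qed.

Let rho_total u1 : sq_num (u1 : sq_ambient (hom_homology D1 D2 M1)) ->
  exists2 u2, sq_num (u2 : sq_ambient (hom_homology D2 D3 M2)) & rho u1 u2.
Proof.
move=> /num_row_hom u10.
have [||h hP hD] := @relatively_projective_factor c _ _ D2 M2
  (tau \o row_hom u1) proj2 reg2.
- exact/twist_Klinear_but/row_hom_linear.
- by move=> w w0; have [[//|v ->] _] := ex12 w; rewrite /= u10.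
have Tl := rel_trace_linear hP.
exists [ffun j => rel_trace c h (delta_mx 0 j)].
  apply/num_row_hom => v; rewrite -(row_homE Tl) /rel_trace scalemxAl !hD.
  exact: (twist_rel_trace v (row_hom_linear u1)).
by exists h; split=> // v; rewrite (row_homE Tl).
Qed.

Let rho_total' u2 : sq_num (u2 : sq_ambient (hom_homology D2 D3 M2)) ->
  exists2 u1, sq_num (u1 : sq_ambient (hom_homology D1 D2 M1)) & rho u1 u2.
Proof.
move=> /num_row_hom u20.
have [phi [phil phiy] phi1] := ex_row_trace1 c d.
pose h := row_hom u2 \o phi.
have hP : Klinear_but c h.
  split.
    by apply: Rlinear_comp => //; exact/linear_Rlinear/row_hom_linear.
  by move=> v; rewrite /h /= phiy (linear_fZ (row_hom_linear _)).
have hT v : rel_trace c h v = row_hom u2 v.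
  rewrite -[in RHS](phi1 v) /rel_trace (linear_fD (row_hom_linear _)).
  by rewrite (linear_fZ (row_hom_linear _)).
have hDP : Klinear_but c (h \o mulmxr D2).
  case: hP => hl hy; split.
    apply: Rlinear_comp => //; apply: linear_Rlinear => r u v /=.
    by rewrite mulmxDl scalemxAl.
  by move=> u /=; rewrite -scalemxAl hy.
have fl := untwist_linear hDP.
have {}fl : linear (tau' \o (h \o mulmxr D2)).
  apply: fl => v; rewrite -(u20 v) -hT /rel_trace /=.
  by rewrite scalemxAl.
exists [ffun j => (tau' \o (h \o mulmxr D2)) (delta_mx 0 j)].
  apply/num_row_hom => v; rewrite -(row_homE fl) /= D12.
  apply: (can_inj tauK); rewrite tau'K tau0; case: hP => hl _; exact: Rlinear0.
by exists h; split=> // v; rewrite -(row_homE fl) /= tau'K.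
Qed.

Let rho_den u1 u2 : rho u1 u2 ->
  (sq_den (u1 : sq_ambient (hom_homology D1 D2 M1)) <->
   sq_den (u2 : sq_ambient (hom_homology D2 D3 M2))).
Proof.
move=> [h [hP hT hD]]; split.
  move=> [g _ gE].
  (* If [u1] bounds [g], then [k] is a cocycle of the acyclic middle term with the same trace as
     [h]; the trace of a cochain bounding [k] bounds [u2]. *)
  pose t v := tau (row_hom g v); pose k v := h v - t v.
  have [tl ty] : Klinear_but c t := twist_Klinear_but (row_hom_linear g).
  have kP : Klinear_but c k.
    case: hP => hl hy; split.
      apply: RlinearP => [u v|r u]; rewrite /k.
        by rewrite (RlinearD hl) (RlinearD tl) opprD addrACA.
      by rewrite (RlinearZ hl) (RlinearZ tl) scalerBr.
    by move=> u; rewrite /k hy ty scalerBr.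
  have [|k' k'P k'D] := relatively_projective_factor proj2 reg3 kP.
    move=> w w0; have [[//|v ->] _] := ex23 w.
    by rewrite /k /t hD -gE row_hom_diff subrr.
  have k'T := rel_trace_linear k'P.
  exists [ffun j => rel_trace c k' (delta_mx 0 j)] => //.
  apply: row_hom_inj => v; rewrite row_hom_diff -(row_homE k'T) -hT.
  rewrite /rel_trace scalemxAl !k'D /k /t.
  have := twist_rel_trace v (row_hom_linear g); rewrite /rel_trace /= => tT.
  by rewrite scalerBr addrACA -opprD tT subr0.
move=> [g _ gE].
have [phi [phil phiy] phi1] := ex_row_trace1 c e.
have gl := linear_Rlinear (row_hom_linear g).
(* Lifting [g] along the trace and subtracting its coboundary gives [k] of trace zero, hence linear
   into [M1], with unchanged composite with [D2]. *)
pose k v := h v - row_hom g (phi (v *m D3)).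
have kP : Klinear_but c k.
  case: hP => hl hy; split.
    apply: RlinearP => [u v|r u]; rewrite /k.
      rewrite (RlinearD hl) mulmxDl (RlinearD phil) (RlinearD gl).
      by rewrite opprD addrACA.
    by rewrite (RlinearZ hl) -scalemxAl (RlinearZ phil) (RlinearZ gl) scalerBr.
  move=> u; rewrite /k hy -scalemxAl phiy (linear_fZ (row_hom_linear _)).
  by rewrite scalerBr.
have kT v : rel_trace c k v = 0.
  rewrite /rel_trace /k scalerBr addrACA -opprD.
  rewrite -[X in X - _]/(rel_trace c h v) hT -gE row_hom_diff.
  rewrite -(linear_fZ (row_hom_linear _)) -(linear_fD (row_hom_linear _)).
  rewrite -scalemxAl -[X in _ - row_hom g X]/(rel_trace c phi (v *m D3)).
  by rewrite phi1 subrr.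
have k'l := untwist_linear kP kT.
exists [ffun j => (tau' \o k) (delta_mx 0 j)] => //.
apply: row_hom_inj => v; rewrite row_hom_diff -(row_homE k'l) /= /k D23.
by rewrite (Rlinear0 phil) (Rlinear0 gl) subr0 hD tauK.
Qed.

Lemma shift_iso (W : lmodType R) :
  sq_iso (hom_homology D1 D2 M1) W <-> sq_iso (hom_homology D2 D3 M2) W.
Proof.
split.
  apply: (@sq_iso_correspondence R (hom_homology D1 D2 M1)
    (hom_homology D2 D3 M2) W rho).
  - exact: hom_homology_closed.
  - exact: hom_homology_closed.
  - exact: rho_lin.
  - exact: rho_total.
  - exact: rho_total'.
  - by move=> u1 u2 _ _; exact: rho_den.
apply: (@sq_iso_correspondence R (hom_homology D2 D3 M2)
  (hom_homology D1 D2 M1) W (fun u2 u1 => rho u1 u2)).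
- exact: hom_homology_closed.
- exact: hom_homology_closed.
- by move=> r u v u' v'; exact: rho_lin.
- exact: rho_total'.
- exact: rho_total.
- by move=> u2 u1 _ _ /rho_den[].
Qed.
End Shift.
End DimensionShift.

(** * The complete resolution *)

Section CompleteResolution.
Variables (R : idomainType) (p : R).
Hypothesis p0 : p != 0.
Hypothesis dvd_total : forall a b : R,
  (exists c, a = c * b) \/ (exists c, b = c * a).
Local Notation K := (Kring p).
Local Notation "r %:K" := (Kconst p r) (at level 1, format "r %:K").

Variable lam : K -> R.
Hypothesis lamP : forall r a b, lam (r%:K * a + b) = r * lam a + lam b.
Hypothesis lam_expand :
  forall a, a = \sum_e (lam (a * Kdual p e))%:K * Kbasis p e.
Hypothesis lam_xy : lam (Kx p * Ky p) = 1.

Lemma KconstM r s : (r * s)%:K = r%:K * s%:K.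
Proof. exact: (rmorphM (in_alg K)). Qed.

Lemma KconstD r s : (r + s)%:K = r%:K + s%:K.
Proof. exact: (rmorphD (in_alg K)). Qed.

Lemma Kconst0 : 0%:K = 0.
Proof. exact: (rmorph0 (in_alg K)). Qed.

Lemma Kconst1 : 1%:K = 1.
Proof. exact: (rmorph1 (in_alg K)). Qed.

Lemma Kconst_sum (I : finType) (F : I -> R) :
  (\sum_i F i)%:K = \sum_i (F i)%:K.
Proof. exact: (rmorph_sum (in_alg K)). Qed.

Lemma lamD a b : lam (a + b) = lam a + lam b.
Proof. by have := lamP 1 a b; rewrite Kconst1 !mul1r. Qed.

Lemma lam0 : lam 0 = 0.
Proof. by apply: (addrI (lam 0)); rewrite -lamD !addr0. Qed.

Lemma lamZ r a : lam (r%:K * a) = r * lam a.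
Proof. by have := lamP r a 0; rewrite lam0 !addr0. Qed.

Lemma lam_sum (I : finType) (F : I -> K) :
  lam (\sum_i F i) = \sum_i lam (F i).
Proof. exact: (big_morph lam lamD lam0). Qed.

Lemma lam_inj a : (forall e, lam (a * Kdual p e) = 0) -> a = 0.
Proof.
move=> a0; rewrite (lam_expand a) big1 // => e _.
by rewrite a0 Kconst0 mul0r.
Qed.

Definition form b (u v : 'rV[K]_b) := lam (\sum_j u 0 j * v 0 j).

Lemma formC b (u v : 'rV[K]_b) : form u v = form v u.
Proof. by congr (lam _); apply: eq_bigr => j _; rewrite mulrC. Qed.

Lemma formD b (u v w : 'rV[K]_b) : form u (v + w) = form u v + form u w.
Proof.
rewrite -lamD -big_split; congr (lam _); apply: eq_bigr => j _.
by rewrite mxE mulrDr.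
Qed.

Lemma formZ b r (u v : 'rV[K]_b) : form u (r%:K *: v) = r * form u v.
Proof.
rewrite -lamZ mulr_sumr; congr (lam _); apply: eq_bigr => j _.
by rewrite mxE mulrCA.
Qed.

Lemma form0 b (u : 'rV[K]_b) : form u 0 = 0.
Proof. by rewrite /form big1 ?lam0 // => j _; rewrite mxE mulr0. Qed.

Lemma formB b (u v w : 'rV[K]_b) : form u (v - w) = form u v - form u w.
Proof. by apply: (addIr (form u w)); rewrite -formD !subrK. Qed.

Lemma form_delta b (v : 'rV[K]_b) a j :
  form (a *: delta_mx 0 j) v = lam (a * v 0 j).
Proof.
rewrite /form (bigD1 j) //= !mxE !eqxx mulr1 big1 ?addr0 // => i ij.
by rewrite !mxE (negPf ij) andbF mulr0 mul0r.
Qed.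

Lemma form_inj b (v w : 'rV[K]_b) : (forall u, form u v = form u w) -> v = w.
Proof.
move=> vw; apply/eqP; rewrite -subr_eq0; apply/eqP/rowP => j.
rewrite [RHS]mxE; apply: lam_inj => e.
by rewrite mulrC -form_delta formB vw subrr.
Qed.

Lemma form_mulmx a b (D : 'M[K]_(a, b)) u v :
  form (u *m D) v = form u (v *m D^T).
Proof.
congr (lam _); under eq_bigr => j _ do rewrite mxE mulr_suml.
rewrite exchange_big; apply: eq_bigr => i _ /=.
rewrite mxE mulr_sumr; apply: eq_bigr => j _.
by rewrite [D^T _ _]mxE mulrA mulrAC.
Qed.

(** Since [form] takes values in R, maps that are only R-linear have adjoints: [s' v] is rebuilt
    through the dual basis from its pairings with an R-basis. *)
Lemma form_adjoint a b (s : 'rV[K]_a -> 'rV[K]_b) : Rlinear s ->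
  exists2 s' : 'rV[K]_b -> 'rV[K]_a, Rlinear s' &
    forall u v, form (s u) v = form u (s' v).
Proof.
move=> sl.
pose s' v : 'rV[K]_a :=
  \row_j \sum_e (form (s (Kbasis p e *: delta_mx 0 j)) v)%:K * Kdual p e.
exists s'.
  apply: RlinearP => [u v|r u]; apply/rowP => j; rewrite !mxE.
    rewrite -big_split; apply: eq_bigr => e _.
    by rewrite formD KconstD mulrDl.
  rewrite mulr_sumr; apply: eq_bigr => e _.
  by rewrite formZ KconstM -mulrA.
move=> u v.
have uE : u = \sum_j \sum_e (lam (u 0 j * Kdual p e))%:K *:
    (Kbasis p e *: delta_mx 0 j).
  rewrite {1}(row_sum_delta u); apply: eq_bigr => j _.
  rewrite {1}(lam_expand (u 0 j)) scaler_suml; apply: eq_bigr => e _.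
  by rewrite scalerA.
have -> : form (s u) v = \sum_j \sum_e lam (u 0 j * Kdual p e) *
    form (s (Kbasis p e *: delta_mx 0 j)) v.
  rewrite {1}uE (Rlinear_sum sl) formC.
  have fs (I : finType) (F : I -> 'rV[K]_b) :
      form v (\sum_i F i) = \sum_i form v (F i).
    by apply: (big_morph (form v)) => [x y|]; [exact: formD|exact: form0].
  rewrite fs; apply: eq_bigr => j _; rewrite (Rlinear_sum sl) fs.
  by apply: eq_bigr => e _; rewrite (RlinearZ sl) formZ formC.
rewrite [RHS]/form lam_sum; apply: eq_bigr => j _.
rewrite mxE mulr_sumr lam_sum; apply: eq_bigr => e _.
move: (Kdual p e) (form _ _) (u 0 j) => d f a'; by rewrite mulrC -lamZ mulrCA.
Qed.

(** The adjoint of multiplication by [D] is multiplication by its transpose, so taking adjoints in D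
    s D = D proves it. *)
Lemma regular_tr a b (D : 'M[K]_(a, b)) : regular D -> regular D^T.
Proof.
move=> [s sl sP]; have [s' s'l s'P] := form_adjoint sl; exists s' => // v.
apply: form_inj => u.
by rewrite -!form_mulmx -s'P -form_mulmx sP.
Qed.

Lemma exact_mulmx a b d (D1 : 'M[K]_(a, b)) (D2 : 'M[K]_(b, d)) :
  exact_at D1 D2 -> D1 *m D2 = 0.
Proof.
move=> ex; apply/row_matrixP => i; rewrite row0 row_mul.
by have [_] := ex (row i D1); apply; exists (delta_mx 0 i); rewrite rowE.
Qed.

(** If [u] is killed by the transpose of [D1], pairing with [u] vanishes on the image of [D1], which
    is the kernel of [D2]; the inner inverse of [D2] then factors this functional through [D2]. *)
Lemma exact_tr a b d (D1 : 'M[K]_(a, b)) (D2 : 'M[K]_(b, d)) :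
  exact_at D1 D2 -> regular D2 -> exact_at D2^T D1^T.
Proof.
move=> ex [s sl sP]; have [s' s'l s'P] := form_adjoint sl.
move=> u; split=> [u0|[v ->]]; last first.
  by rewrite -mulmxA -trmx_mul (exact_mulmx ex) trmx0 mulmx0.
exists (s' u); apply: form_inj => w.
rewrite -form_mulmx -s'P.
have [|v vE] := proj1 (ex (s (w *m D2) - w)).
  by rewrite mulmxBl sP subrr.
rewrite -(subrK w (s _)) vE [RHS]formC formD !(formC u) form_mulmx u0.
by rewrite form0 add0r.
Qed.

Lemma row_fin_gen b : fin_gen (overR 'rV[K]_b).
Proof.
apply: (@fin_gen_finType _ _ ('I_b * (bool * bool))%type
  (fun i => Kbasis p i.2 *: delta_mx 0 i.1 : overR 'rV[K]_b)) => u.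
exists (fun i => lam (u 0 i.1 * Kdual p i.2)).
rewrite -(pair_bigA _ (fun j e => lam (u 0 j * Kdual p e) *:
  (Kbasis p e *: delta_mx 0 j : overR 'rV[K]_b))) /=.
rewrite {1}(row_sum_delta u); apply: eq_bigr => j _.
rewrite {1}(lam_expand (u 0 j)) scaler_suml; apply: eq_bigr => e _.
by rewrite -scalerA.
Qed.

Let coord b (i : 'I_b * (bool * bool)) (v : overR 'rV[K]_b) : R :=
  lam ((v : 'rV[K]_b) 0 i.1 * Kdual p i.2).

Let coord_functional b i : functional (@coord b i).
Proof.
move=> r u v; rewrite /coord -lamP; congr (lam _).
by rewrite mulrA -mulrDl; congr (_ * _); rewrite !mxE.
Qed.

Let coord_inj b (v : overR 'rV[K]_b) : (forall i, coord i v = 0) -> v = 0.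
Proof.
move=> v0; apply/rowP => j; rewrite mxE; apply: lam_inj => e.
exact: (v0 (j, e)).
Qed.

(** Exactness presents the image of [D1] as the common kernel of the R-coordinates of multiplication
    by [D2]. *)
Lemma exact_regular a b d (D1 : 'M[K]_(a, b)) (D2 : 'M[K]_(b, d)) :
  exact_at D1 D2 -> regular D1.
Proof.
move=> ex.
have Dl m n (D : 'M[K]_(m, n)) :
    linear ((fun u => u *m D) : overR 'rV[K]_m -> overR 'rV[K]_n).
  by apply: linear_Rlinear => r u v; rewrite mulmxDl scalemxAl.
have [s [sl sP]] := @regular_of_functionals R dvd_total _ _
  ((fun u => u *m D1) : overR 'rV[K]_a -> overR 'rV[K]_b) _ _ (@coord b)
  (fun i (v : overR 'rV[K]_b) => @coord d i ((v : 'rV[K]_b) *m D2))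
  (row_fin_gen a) (row_fin_gen b) (Dl _ _ D1) (@coord_functional b)
  (fun i r u v => etrans (congr1 (coord i) (Dl _ _ D2 r u v))
     (coord_functional i r _ _))
  (@coord_inj b)
  (fun v => conj
     (fun im i => etrans (congr1 (coord i) (proj2 (ex v) im))
        (functional0 (coord_functional i)))
     (fun v0 => proj1 (ex v) (coord_inj v0))).
by exists s.
Qed.

(** * Splicing the resolution with its dual *)

Variable P : free_resolution (Rpp p).
Local Notation D := (fr_diff P).
Local Notation r0 := (fr_rank P 0).

Definition aug (v : 'rV[K]_r0) : R := fr_aug P v.

Lemma augD u v : aug (u + v) = aug u + aug v.
Proof. exact: linearD. Qed.

Lemma augZ a v : aug (a *: v) = Kaug a * aug v.
Proof. exact: (linearZ_LR (fr_aug P) a v). Qed.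

Lemma aug_sum (I : finType) (F : I -> 'rV[K]_r0) :
  aug (\sum_i F i) = \sum_i aug (F i).
Proof. exact: (linear_sum (fr_aug P)). Qed.

Definition aug_coord j : R := aug (delta_mx 0 j).
Local Notation eps := aug_coord.

Lemma augE v : aug v = \sum_j Kaug (v 0 j) * eps j.
Proof.
rewrite {1}(row_sum_delta v) aug_sum.
by apply: eq_bigr => j _; rewrite augZ.
Qed.

Lemma KaugE (a : K) : Kaug a = (Kval a).1.1.
Proof. by []. Qed.

Lemma Kaug_const r : Kaug r%:K = r.
Proof. by rewrite KaugE Kval_const. Qed.

Lemma Kaug_xy (a : K) : a * (Kx p * Ky p) = (Kaug a)%:K * (Kx p * Ky p).
Proof.
apply: Kval_inj; rewrite !KvalM !KvalKx !KvalKy Kval_const KaugE.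
case: (Kval a) => [[a1 a2] [a3 a4]].
by congr ((_, _), (_, _)); rewrite /=; ring.
Qed.

Lemma mul_const_xy (a : K) r :
  a * (r%:K * (Kx p * Ky p)) = (Kaug a * r)%:K * (Kx p * Ky p).
Proof.
rewrite (mulrCA a) (Kaug_xy a) (mulrA r%:K) -KconstM.
by rewrite [r * _]mulrC.
Qed.

(* P_0 -> R -> Hom(P_0, K), which splices P and its dual into a complete
   resolution. *)
Definition norm_mx : 'M[K]_(r0, r0) :=
  \matrix_(i, j) ((eps i * eps j)%:K * (Kx p * Ky p)).
Local Notation N := norm_mx.

Lemma norm_mx_tr : N^T = N.
Proof. by apply/matrixP => i j; rewrite !mxE [eps j * _]mulrC. Qed.

Lemma mul_norm_mx v j : (v *m N) 0 j = (aug v * eps j)%:K * (Kx p * Ky p).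
Proof.
rewrite mxE augE mulr_suml Kconst_sum mulr_suml; apply: eq_bigr => i _.
by rewrite mxE mul_const_xy (mulrA (Kaug _)).
Qed.

Lemma ex_aug1 : exists u, aug u = 1.
Proof. exact: (fr_aug_surj P 1). Qed.

Lemma exact_aug u : aug u = 0 <-> exists v, u = v *m D 0.
Proof. exact (@fr_exact0 _ _ P u). Qed.

Lemma exact_norm : exact_at (D 0) N.
Proof.
move=> u; rewrite -exact_aug; split=> [uN|u0]; last first.
  by apply/rowP => j; rewrite mul_norm_mx u0 mul0r Kconst0 mul0r mxE.
have [w w1] := ex_aug1.
rewrite -[aug u]mulr1 -w1 (augE w) mulr_sumr big1 // => j _.
(* The [eps j] generate the unit ideal, because [aug w = 1]; it is enough that each of them kills
   [aug u]. *)
rewrite mulrCA.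
suff -> : aug u * eps j = 0 by rewrite mulr0.
have := mul_norm_mx u j; rewrite uN mxE => /(congr1 lam).
by rewrite lam0 lamZ lam_xy mulr1.
Qed.

(** [N] is [aug] followed by its dual. Pairing with a vector [w] of augmentation 1 recovers [aug v]
    from [v *m N], and the corresponding multiple of [w] has the same image as [v]. *)
Lemma regular_norm : regular N.
Proof.
have [w w1] := ex_aug1.
exists (fun v => (form w v)%:K *: w).
  apply: RlinearP => [u v|r u].
    by rewrite formD KconstD scalerDl.
  by rewrite formZ KconstM scalerA.
move=> v.
have -> : form w (v *m N) = aug v.
  rewrite /form; under eq_bigr => j _ do rewrite mul_norm_mx mul_const_xy.
  rewrite -mulr_suml -Kconst_sum lamZ lam_xy mulr1.
  under eq_bigr => j _ do rewrite mulrCA.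
  by rewrite -mulr_sumr -augE w1 mulr1.
apply/rowP => j; rewrite -scalemxAl mxE !mul_norm_mx w1 mul1r.
by rewrite mulrA -KconstM.
Qed.

Lemma exact_norm_dual : exact_at N (D 0)^T.
Proof. by rewrite -{1}norm_mx_tr; apply: exact_tr exact_norm regular_norm. Qed.

Lemma exact_diff n : exact_at (D n.+1) (D n).
Proof. by move=> u; exact: fr_exact. Qed.

Lemma regular_diff n : regular (D n).
Proof.
case: n => [|n]; apply: exact_regular; [exact: exact_norm|exact: exact_diff].
Qed.

Lemma exact_dual n : exact_at (D n)^T (D n.+1)^T.
Proof. by apply: exact_tr; [exact: exact_diff|exact: regular_diff]. Qed.

End CompleteResolution.

(** * Tate cohomology of exact modules *)

Section TateOfExact.
Variables (R : idomainType) (p : R).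
Hypothesis p0 : p != 0.
Hypothesis dvd_total : forall a b : R,
  (exists c, a = c * b) \/ (exists c, b = c * a).
Local Notation K := (Kring p).
Local Notation gen := (gen p).
Local Notation "r %:K" := (Kconst p r) (at level 1, format "r %:K").
Variable P : free_resolution (Rpp p).
Local Notation D := (fr_diff P).
Local Notation N := (norm_mx P).
Local Notation eps := (@aug_coord _ _ P).

Definition Kinvariant (M : lmodType K) (m : M) :=
  Kx p *: m = p%:K *: m /\ Ky p *: m = p%:K *: m.

Lemma invariant_scale (M : lmodType K) (m : M) a :
  Kinvariant m -> a *: m = (Kaug a)%:K *: m.
Proof.
move=> [mx my].
have [r [s [t [u ->]]]] := gen_span true a.
have -> : gen true = Kx p by []. have -> : gen (~~ true) = Ky p by [].
have xym : Kx p *: (Ky p *: m) = (p * p)%:K *: m.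
  by rewrite my scalerA mulrC -scalerA mx scalerA KconstM.
rewrite !scalerDl -!scalerA xym mx my !scalerA -!KconstM -!scalerDl.
apply: (congr1 (fun r => r%:K *: m)).
by rewrite KaugE !(KvalKx, KvalKy, KvalE) /=; ring.
Qed.

Lemma invariant_lincomb (M : lmodType K) r (u v : M) :
  Kinvariant u -> Kinvariant v -> Kinvariant (r%:K *: u + v).
Proof.
move=> [ux uy] [vx vy].
by split; rewrite !scalerDr (scalerA _ r%:K) [_ * r%:K]mulrC -scalerA ?ux ?uy
  ?vx ?vy !scalerA [r%:K * _]mulrC.
Qed.

Lemma invariant_xy (M : lmodType K) (m : M) : Kinvariant ((Kx p * Ky p) *: m).
Proof.
have xx := gen_sqr p true; have yy := gen_sqr p false.
split; rewrite !scalerA; congr (_ *: _).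
  by rewrite mulrA [LHS](congr1 (fun z => z * Ky p) xx) mulrA.
by rewrite mulrCA [LHS](congr1 (fun z => Kx p * z) yy) mulrCA.
Qed.

(** Maps killing the image of [D 0] factor through [aug], hence are v -> aug(v) m with m invariant;
    those that factor through [N] have m in xyM. *)
Lemma hom_homology_norm (M : lmodType K) (W : lmodType R) :
  sq_iso (tate P M 0) W -> sq_iso (hom_homology (D 0) N M) W.
Proof.
have [w w1] := ex_aug1 P.
have inv_sum (m : M) v : Kinvariant m ->
    row_hom [ffun j => (eps j)%:K *: m] v = (aug (P := P) v)%:K *: m.
  move=> mI; rewrite augE Kconst_sum scaler_suml; apply: eq_bigr => j _.
  by rewrite ffunE scalerA mulrC -scalerA (invariant_scale _ mI) scalerA
             -KconstM mulrC.
apply: (@sq_iso_correspondence R (tate P M 0) (hom_homology (D 0) N M) W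
  (fun m u => u = [ffun j => (eps j)%:K *: (m : M)])).
- by move=> r u v; exact: invariant_lincomb.
- exact: hom_homology_closed.
- move=> r u v _ _ -> ->; apply/ffunP => j; rewrite !ffunE scalerDr.
  by congr (_ + _); rewrite !scalerA mulrC.
- move=> m mI; eexists; last reflexivity.
  apply: row_hom_inj => v; rewrite row_hom_diff inv_sum //.
  have [_ ->] := exact_aug (P := P) (v *m D 0); last by exists v.
  by rewrite Kconst0 scale0r /row_hom big1 // => j _; rewrite ffunE scaler0.
- move=> u u0.
  have kill v : aug (P := P) v = 0 -> row_hom (u : {ffun _ -> M}) v = 0.
    move=> /exact_aug[y ->]; rewrite -row_hom_diff u0.
    by rewrite /row_hom big1 // => j _; rewrite ffunE scaler0.
  have hl := row_hom_linear (u : {ffun _ -> M}).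
  have same v y : aug (P := P) v = aug (P := P) y ->
      row_hom (u : {ffun _ -> M}) v = row_hom (u : {ffun _ -> M}) y.
    move=> vy; apply/eqP; rewrite -subr_eq0 -(linear_fB hl); apply/eqP/kill.
    by rewrite -[v - y]addrC -scaleN1r augD augZ rmorphN1 mulN1r vy addNr.
  exists (row_hom (u : {ffun _ -> M}) w).
    split; rewrite -!(linear_fZ hl); apply: same; rewrite !augZ w1 !mulr1.
      by rewrite -[p%:A]/(p%:K) !KaugE KvalKx Kval_const.
    by rewrite -[p%:A]/(p%:K) !KaugE KvalKy Kval_const.
  apply/ffunP => j; rewrite ffunE -(linear_fZ hl) -row_hom_delta; apply: same.
  by rewrite augZ w1 mulr1 Kaug_const.
- move=> m u mI _ ->; split=> [[m' ->]|[g _ gE]].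
    (* The weights [w 0 j] are chosen so that the sum of the [eps j] times their augmentations is
       1. *)
    exists [ffun j => w 0 j *: m'] => //.
    apply/ffunP => i; rewrite !ffunE.
    under eq_bigr => j _ do
      rewrite !ffunE mxE scalerA [_ * w 0 j]mulrC mul_const_xy.
    rewrite -scaler_suml -mulr_suml -Kconst_sum.
    under eq_bigr => j _ do rewrite mulrCA.
    by rewrite -mulr_sumr -augE w1 mulr1 -scalerA.
  exists (\sum_j (eps j)%:K *: g j).
  have gE' : ext_diff N g =
      [ffun i => (eps i)%:K *: ((Kx p * Ky p) *: (\sum_j (eps j)%:K *: g j))].
    apply/ffunP => i; rewrite !ffunE !scaler_sumr; apply: eq_bigr => j _.
    rewrite mxE !scalerA; congr (_ *: _).
    by rewrite KconstM -!mulrA; congr (_ * _); rewrite mulrC -mulrA.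
  have := congr1 (fun u : {ffun _ -> M} => row_hom u w) gE.
  by rewrite gE' !inv_sum ?w1 ?Kconst1 ?scale1r //; exact: invariant_xy.
Qed.

Variables (c : bool) (M : lmodType K).

(** M for [false] and M' for [true], so that each shift of degree negates [b]. *)
Definition twist (b : bool) : lmodType K := 
  if b then (restrict (flip c) M : lmodType K) else M.

Let tau b : twist b -> twist (~~ b) :=
  match b return twist b -> twist (~~ b) with true => id | false => id end.

Let tauK b : cancel (@tau b) (match b return twist (~~ b) -> twist b with
  true => id | false => id end).
Proof. by case: b. Qed.

Let tau'K b : cancel (match b return twist (~~ b) -> twist b with
  true => id | false => id end) (@tau b).
Proof. by case: b. Qed.

Let tauD b u v : @tau b (u + v) = tau u + tau v.
Proof. by case: b u v. Qed.

Let tauZ b a u : @tau b (a *: u) = flip c a *: tau u.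
Proof.
case: b u => u //.
by rewrite -[in LHS](flipK c a).
Qed.

Hypothesis projM : relatively_projective (~~ c) M.

Let proj_twist b : relatively_projective (~~ c) (twist b).
Proof.
case: b => //; have [beta bl bP] := projM.
have sE (a : K) (m : M) : a *: (m : restrict (flip c) M) = flip c a *: m.
  by [].
exists beta.
  apply: RlinearP => [u v|r u]; first exact: (RlinearD bl).
  by rewrite !sE flip_const; exact: (RlinearZ bl).
move=> m; rewrite !sE.
rewrite (rmorphB (flip c : {rmorphism K -> K})) /= flip_genC flip_const.
exact: bP.
Qed.

Let shift b (W : lmodType R) a a' d e (D1 : 'M[K]_(a, a')) (D2 : 'M[K]_(a', d))
    (D3 : 'M[K]_(d, e)) :
  exact_at D1 D2 -> exact_at D2 D3 -> regular D2 -> regular D3 ->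
  sq_iso (hom_homology D1 D2 (twist b)) W <->
  sq_iso (hom_homology D2 D3 (twist (~~ b))) W.
Proof.
move=> ex12 ex23 reg2 reg3.
exact: (shift_iso p0 (@tauK b) (@tau'K b) (@tauD b) (@tauZ b)).
Qed.

(** From degree n + 1 to degree 0 there are n + 1 shifts, each of which twists once. *)
Lemma Ext_iso n b (W : lmodType R) :
  sq_iso (hom_homology (D 0) N (twist (b (+) odd n.+1))) W ->
  sq_iso (Ext P (twist b) n.+1) W.
Proof.
have [lam [lamP lam_expand lam_xy]] := ex_Frobenius_form p0.
have ex0 := exact_norm lamP lam_xy (P := P).
have exn := @exact_diff _ _ P.
have reg n' := regular_diff dvd_total lamP lam_expand lam_xy P n'.
have regN := regular_norm lamP lam_xy P.
elim: n b => [|n IHn] b.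
  move=> H; apply/(shift b W (exn 0) ex0 (reg 0) regN).
  by rewrite addbT in H.
move=> H; apply/(shift b W (exn n.+1) (exn n) (reg n.+1) (reg n)).
by apply: IHn; rewrite addNb -addbN.
Qed.

Lemma TorE (M' : lmodType K) n :
  Tor P M' n.+1 = hom_homology (D n)^T (D n.+1)^T M'.
Proof.
have torE a b (E : 'M[K]_(a, b)) :
    tor_diff E (M := M') = ext_diff E^T (M := M').
  apply/funext => u; apply/ffunP => j; rewrite !ffunE; apply: eq_bigr => i _.
  by rewrite mxE.
by rewrite /Tor /hom_homology !torE.
Qed.

(** Between [N] and degree -(n + 2) there are n + 2 shifts, two of them already for n = 0; hence the
    parity of n. *)
Lemma Tor_iso n b (W : lmodType R) :
  sq_iso (hom_homology (D 0) N (twist (b (+) odd n))) W ->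
  sq_iso (Tor P (twist b) n.+1) W.
Proof.
have [lam [lamP lam_expand lam_xy]] := ex_Frobenius_form p0.
have ex0 := exact_norm lamP lam_xy (P := P).
have exN := exact_norm_dual lamP lam_expand lam_xy (P := P).
have exn := exact_dual dvd_total lamP lam_expand lam_xy (P := P).
have reg n' := regular_tr lamP lam_expand
  (regular_diff dvd_total lamP lam_expand lam_xy P n').
have regN := regular_norm lamP lam_xy P.
rewrite TorE; elim: n b => [|n IHn] b.
  rewrite addbF => /(shift _ _ ex0 exN regN (reg 0)).
  by move=> /(shift _ _ exN (exn 0) (reg 0) (reg 1)); rewrite negbK.
move=> H; rewrite -[b]negbK.
apply/(shift (~~ b) W (exn n) (exn n.+1) (reg n.+1) (reg n.+2)).
by apply: IHn; rewrite addNb -addbN.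
Qed.

Definition gen_exact (c' : bool) (M' : lmodType K) :=
  (forall m : M', gen c' *: m = 0 -> exists m', m = (gen c' - p%:K) *: m') /\
  (forall m : M', (gen c' - p%:K) *: m = 0 -> exists m', m = gen c' *: m').

Hypothesis exM : gen_exact (~~ c) M.

Lemma invariant_twist (u : M) :
  @Kinvariant (twist true) u <->
  gen c *: u = 0 /\ gen (~~ c) *: u = p%:K *: u.
Proof.
have sE (a : K) (m : M) : (a *: (m : twist true)) = flip c a *: m by [].
have gE c' : (p%:K - gen c') *: u = p%:K *: u <-> gen c' *: u = 0.
  rewrite scalerBl; split=> [/eqP|->]; last exact: subr0.
  by rewrite -subr_eq0 addrAC subrr sub0r oppr_eq0 => /eqP.
rewrite /Kinvariant !sE flip_const.
rewrite -[Kx p]/(gen true) -[Ky p]/(gen false).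
move: (flip_gen p c) (flip_genC p c); case: c.
  rewrite -[~~ true]/false => -> ->.
  by split=> -[/gE ? ?]; split=> //; apply/gE.
rewrite -[~~ false]/true => -> ->.
by split=> -[? ?]; split=> //; apply/gE.
Qed.

(** Multiplication by Y = [gen (~~ c)] maps the kernel of xy onto the invariants of M', that is, the
    u with [gen c] u = 0 and Yu = pu, with kernel (Y - p)M. Both surjectivity and the kernel use
    exactness. *)
Lemma tate_neg1_iso (W : lmodType R) :
  sq_iso (tate P (twist true) 0) W -> sq_iso (tate P M (-1)) W.
Proof.
have xyE : Kx p * Ky p = gen c * gen (~~ c) by case: c => //; exact: mulrC.
have [ex1 ex2] := exM.
have yy (m : M) : gen (~~ c) *: (gen (~~ c) *: m) = p%:K *: (gen (~~ c) *: m).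
  by rewrite !scalerA gen_sqr.
have yk (m : M) : gen (~~ c) *: ((gen (~~ c) - p%:K) *: m) = 0.
  by rewrite scalerA mulrBr gen_sqr [_ * p%:K]mulrC subrr scale0r.
apply: (@sq_iso_correspondence R (tate P (twist true) 0) (tate P M (-1)) W
  (fun u m => (u : M) = gen (~~ c) *: (m : M))).
- by move=> r u v; exact: invariant_lincomb.
- move=> r u v /= u0 v0.
  change ((Kx p * Ky p) *: (r%:K *: (u : M) + v) = 0).
  by rewrite scalerDr v0 scalerA mulrC -scalerA u0 scaler0 addr0.
- move=> r u v u' v' -> ->.
  change (flip c r%:K *: (gen (~~ c) *: (u' : M)) + gen (~~ c) *: (v' : M) =
    gen (~~ c) *: (r%:K *: (u' : M) + v')).
  by rewrite flip_const scalerDr !scalerA mulrC.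
- move=> u /invariant_twist[xu yu].
  have [|m uE] := ex2 u; first by rewrite scalerBl yu subrr.
  by exists m => //; rewrite /= xyE -scalerA -uE.
- move=> m /= m0; exists (gen (~~ c) *: (m : M)) => //.
  by apply/invariant_twist; rewrite scalerA -xyE m0 yy.
- move=> u m _ _ /= uE.
  have denE (v : M) : ((Kx p * Ky p) *: (v : twist true) : M) =
      gen (~~ c) *: ((p%:K - gen c) *: v).
    transitivity (flip c (Kx p * Ky p) *: v); first by [].
    rewrite xyE (rmorphM (flip c : {rmorphism K -> K})) /= flip_gen flip_genC.
    by rewrite mulrC -scalerA.
  have dE : (exists v w : M, (m : M) = (Kx p - p%:K) *: v + (Ky p - p%:K) *: w)
      <-> (exists v w : M,
        (m : M) = (gen c - p%:K) *: v + (gen (~~ c) - p%:K) *: w).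
    by case: c => //; split=> -[v [w ->]]; exists w, v; exact: addrC.
  apply: iff_trans (iff_sym dE); split=> [[v0 vE]|[v [w mE]]].
    pose v : M := v0.
    have [|w wE] := ex1 ((m : M) - (p%:K - gen c) *: v).
      rewrite scalerBr; apply/eqP; rewrite subr_eq0; apply/eqP.
      exact: (etrans (esym uE) (etrans vE (denE v))).
    exists (- v), w; rewrite -wE scalerN -scaleNr opprB addrC.
    exact: esym (subrK _ _).
  exists (- v : M); apply: etrans uE (etrans _ (esym (denE _))).
  by rewrite mE scalerDr yk addr0 scalerN -scaleNr opprB.
Qed.

Lemma tate_iso n (W : lmodType R) :
  sq_iso (tate P (twist (odd `|n|%N)) 0) W -> sq_iso (tate P M n) W.
Proof.
case: n => [[|n]|[|n]] //= H; last 2 first.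
- exact: tate_neg1_iso.
- rewrite negbK in H.
  by apply: (@Tor_iso n false); rewrite addFb; exact: hom_homology_norm.
by apply: (@Ext_iso n false); rewrite addFb; exact: hom_homology_norm.
Qed.
End TateOfExact.

(** * Exact lattices *)

Lemma complete_dvr_dvd_total (R : idomainType) (p : R) : complete_dvr p ->
  forall a b : R, (exists c, a = c * b) \/ (exists c, b = c * a).
Proof.
move=> dvr a b.
have [->|a0] := eqVneq a 0; first by left; exists 0; rewrite mul0r.
have [->|b0] := eqVneq b 0; first by right; exists 0; rewrite mul0r.
have [u [n [uU ->]]] := cdvr_valuation dvr a0.
have [w [m [wU ->]]] := cdvr_valuation dvr b0.
have [le|/ltnW le] := leqP m n; [left|right].
  exists (u / w * p ^+ (n - m)).
  by rewrite -(subnKC le) addKn exprD mulrACA divrK // [p ^+ _ * _]mulrC.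
exists (w / u * p ^+ (m - n)).
by rewrite -(subnKC le) addKn exprD mulrACA divrK // [p ^+ _ * _]mulrC.
Qed.

Section LatticeSplitting.
Variable R : idomainType.

Lemma lattice_torsion_free (L : algType R) (M : lattice L) (r : R) (u : M) :
  r != 0 -> r%:A *: u = 0 -> u = 0.
Proof.
move=> r0 ru; have [n [b [b' bK b'K]]] := latP M.
have b0 : b' u = 0.
  have : r *: b' u = 0.
    by apply: (can_inj bK); rewrite linearZ linear0 b'K.
  move=> /rowP rb; apply/rowP => i; apply: (mulfI r0).
  by have := rb i; rewrite !mxE mulr0.
by rewrite -(b'K u) b0 linear0.
Qed.

Lemma lattice_fin_gen (L : algType R) (M : lattice L) : fin_gen (overR M).
Proof.
have [n [b [b' bK b'K]]] := latP M.
exists n, (fun i => b (delta_mx 0 i)) => m; exists (fun i => b' m 0 i).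
rewrite -[LHS](b'K m) {1}(row_sum_delta (b' m)) linear_sum.
by apply: eq_bigr => i _; rewrite linearZ.
Qed.

Lemma lattice_functionals (L : algType R) (M : lattice L) :
  exists n (l : 'I_n -> overR M -> R), (forall i, functional (l i)) /\
    forall v, (forall i, l i v = 0) -> v = 0.
Proof.
have [n [b [b' bK b'K]]] := latP M.
exists n, (fun i v => b' v 0 i); split=> [i r u v|v v0].
  have -> : b' (r *: u + v) = r *: b' u + b' v.
    by apply: (can_inj bK); rewrite linearP !b'K.
  by rewrite !mxE.
rewrite -[v]b'K -[RHS](linear0 b); congr (b _).
by apply/rowP => i; rewrite v0 mxE.
Qed.

Variable p : R.
Local Notation K := (Kring p).
Local Notation gen := (gen p).
Local Notation "r %:K" := (Kconst p r) (at level 1, format "r %:K").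
Hypothesis dvd_total : forall a b : R,
  (exists c, a = c * b) \/ (exists c, b = c * a).

Lemma scale_Rlinear (M : lmodType K) a : Rlinear (fun m : M => a *: m).
Proof.
apply: RlinearP => [u v|r u]; first exact: scalerDr.
by rewrite !scalerA mulrC.
Qed.

Lemma lattice_regular (M : lattice K) (a b : K) :
  (forall m : M, (exists u, m = a *: u) <-> b *: m = 0) ->
  exists2 s : M -> M, Rlinear s & forall u, a *: s (a *: u) = a *: u.
Proof.
move=> ab; have [n [l [lP l0]]] := lattice_functionals M.
have [||s [sl sP]] := @regular_of_functionals R dvd_total _ _
  ((fun u => a *: u) : overR M -> overR M) _ _ l
  (fun i (m : overR M) => l i (b *: (m : M)))
  (lattice_fin_gen M) (lattice_fin_gen M) (@scale_Rlinear M a) lP _ l0.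
- move=> i r u v; rewrite -lP; congr (l i _).
  exact: (@scale_Rlinear M b).
- move=> v; split=> [/ab bv i|bv]; first by rewrite bv (functional0 (lP i)).
  exact/ab/l0.
by exists s.
Qed.

Lemma gen_exact_relatively_projective c (M : lattice K) :
  gen_exact c M -> relatively_projective c M.
Proof.
move=> [exY exZ].
have YZ (m : M) : gen c *: ((gen c - p%:K) *: m) = 0.
  by rewrite scalerA mulrBr gen_sqr [_ * p%:K]mulrC subrr scale0r.
have ZY (m : M) : (gen c - p%:K) *: (gen c *: m) = 0.
  by rewrite scalerA mulrBl gen_sqr subrr scale0r.
have [|s sl sP] := @lattice_regular M (gen c) (gen c - p%:K).
  by move=> m; split=> [[u ->]|/exZ].
have [|s' s'l s'P] := @lattice_regular M (gen c - p%:K) (gen c).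
  by move=> m; split=> [[u ->]|/exY].
have sZ (m : M) : (gen c - p%:K) *: m = 0 -> gen c *: s m = m.
  by move=> /exZ[u ->].
have s'Y (m : M) : gen c *: m = 0 -> (gen c - p%:K) *: s' m = m.
  by move=> /exY[u ->].
(* Put Y = [gen c] and Z = Y - p. Here [t] projects along ker Y, and [w] corrects [t] to land in ker
   Z. Then [beta] applies the inverse of Z to m - t m, in ker Y = im Z, and that of Y to w m, in ker
   Z = im Y. *)
pose t (m : M) := s (gen c *: m).
have tl : Rlinear t by exact: (Rlinear_comp sl (@scale_Rlinear M (gen c))).
pose z (m : M) := s' ((gen c - p%:K) *: t m).
have zl : Rlinear z :=
  Rlinear_comp s'l (Rlinear_comp (@scale_Rlinear M (gen c - p%:K)) tl).
pose w (m : M) := t m - z m.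
have wl : Rlinear w.
  apply: RlinearP => [u v|r u]; rewrite /w.
    by rewrite (RlinearD tl) (RlinearD zl) opprD addrACA.
  by rewrite (RlinearZ tl) (RlinearZ zl) scalerBr.
pose st (m : M) := s' (m - t m).
have s't : Rlinear st.
  apply: RlinearP => [u v|r u]; rewrite /st.
    by rewrite (RlinearD tl) opprD addrACA (RlinearD s'l).
  by rewrite (RlinearZ tl) -scalerBr (RlinearZ s'l).
pose sw (m : M) := s (w m).
have swl : Rlinear sw := Rlinear_comp sl wl.
exists (fun m => st m + sw m).
  apply: RlinearP => [u v|r u].
    by rewrite (RlinearD s't) (RlinearD swl) addrACA.
  by rewrite (RlinearZ s't) (RlinearZ swl) scalerDr.
move=> m.
have Yt : gen c *: t m = gen c *: m by exact: sP.
have tZ : t ((gen c - p%:K) *: m) = 0 by rewrite /t YZ (Rlinear0 sl).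
have wZ : w ((gen c - p%:K) *: m) = 0.
  by rewrite /w /z tZ scaler0 (Rlinear0 s'l) subrr.
have Zw : (gen c - p%:K) *: w m = 0 by rewrite /w /z scalerBr s'P subrr.
have YV : gen c *: (m - t m) = 0 by rewrite scalerBr Yt subrr.
rewrite /sw /st wZ tZ subr0 (Rlinear0 sl) addr0 scalerDr (sZ _ Zw) /w /z.
have -> : (gen c - p%:K) *: m =
    (gen c - p%:K) *: (m - t m) + (gen c - p%:K) *: t m.
  by rewrite -scalerDr subrK.
rewrite [s' (_ + _ *: t m)](RlinearD s'l) addrACA subrK.
have -> : (gen c - p%:K) *: (m - t m) = - (p%:K *: (m - t m)).
  by rewrite scalerBl YV sub0r.
have s'N (u : M) : s' (- u) = - s' u.
  by rewrite -[- u]sub0r (RlinearB s'l) (Rlinear0 s'l) sub0r.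
rewrite s'N (RlinearZ s'l) -scalerBl (s'Y _ YV).
by rewrite subrK.
Qed.
End LatticeSplitting.

Section Devissage.
Variables (R : idomainType) (p : R).

Lemma gen_exact_extension c (M E N : lattice (Aring p))
    (f : {linear M -> E}) (g : {linear E -> N}) : short_exact f g ->
  gen_exact c (restrictK M) -> gen_exact c (restrictK N) ->
  gen_exact c (restrictK E).
Proof.
move=> [finj gsurj ex] [M1 M2] [N1 N2].
have fZ (a : Kring p) (u : restrictK M) : f (a *: u) = a *: (f u : restrictK E).
  exact: (linearZ_LR f).
have gZ (a : Kring p) (u : restrictK E) : g (a *: u) = a *: (g u : restrictK N).
  exact: (linearZ_LR g).
(* [a] and [b] are the two maps of the periodic complex, in either order. *)
have step (a b : Kring p) : (forall u : restrictK E, a *: (b *: u) = 0) ->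
    (forall u : restrictK M, a *: u = 0 -> exists u', u = b *: u') ->
    (forall u : restrictK N, a *: u = 0 -> exists u', u = b *: u') ->
    forall u : restrictK E, a *: u = 0 -> exists u', u = b *: u'.
  move=> ab Ma Na u au.
  have [|n nE] := Na (g u); first by rewrite -gZ au linear0.
  have [e eE] := gsurj n.
  have [m mE] : exists m,
      (u : E) - (b *: (e : restrictK E) : restrictK E) = f m.
    by apply/ex; rewrite linearB [X in _ - X]gZ eE nE subrr.
  have [|m' m'E] := Ma m.
    apply: finj; rewrite fZ -mE linear0.
    by rewrite scalerBr au ab subrr.
  exists ((e : restrictK E) + (f m' : restrictK E)).
  rewrite scalerDr -fZ -m'E -mE addrC; exact: esym (subrK _ _).
split; apply: step => //.
  move=> u; rewrite scalerA mulrBr gen_sqr [_ * Kconst _ _]mulrC subrr.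
  exact: scale0r.
by move=> u; rewrite scalerA mulrBl gen_sqr subrr scale0r.
Qed.
End Devissage.

(** * Cohomology in terms of Phi *)

Section PhiAnalysis.
Variables (R : idomainType) (p : R) (k : fieldType) (res : {rmorphism R -> k}).
Hypothesis p0 : p != 0.
Local Notation K := (Kring p).
Local Notation gen := (gen p).
Local Notation "r %:K" := (Kconst p r) (at level 1, format "r %:K").
Local Notation idem := (idem R).

Definition Sconst (r : R) : Asharp R := ((r, r), (r, r)).

Lemma SconstE (r : R) : r%:A = Sconst r.
Proof. by congr ((_, _), (_, _)); rewrite /= /GRing.scale /= mulr1. Qed.

Lemma Aval_const (r : R) : Aval (r%:A : Aring p) = Sconst r.
Proof.
have -> : Aval (r%:A : Aring p) = val (r%:A : Aring p) by [].
rewrite linearZ rmorph1; exact: SconstE.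
Qed.

(* The pair of indices whose [gen (~~ c)]-weight is [e] and whose
   [gen c]-weight is [a]. *)
Definition idx1 (c a e : bool) := if c then a else e.
Definition idx2 (c a e : bool) := if c then e else a.

Lemma idem_id a b : idem a b * idem a b = idem a b.
Proof. by case: a b => [] []; congr ((_, _), (_, _)); rewrite /=; ring. Qed.

Lemma idem_orth a b a' b' : (a, b) != (a', b') -> idem a b * idem a' b' = 0.
Proof.
by case: a b a' b' => [] [] [] [] //= _;
   congr ((_, _), (_, _)); rewrite /=; ring.
Qed.

Lemma idem_sum : idem true true + idem true false + idem false true
  + idem false false = 1.
Proof. by congr ((_, _), (_, _)); rewrite /=; ring. Qed.

Lemma sx_idem a b : sx p * idem a b = Sconst (if a then p else 0) * idem a b.
Proof. by case: a b => [] []; congr ((_, _), (_, _)); rewrite /=; ring. Qed.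

Lemma sy_idem a b : sy p * idem a b = Sconst (if b then p else 0) * idem a b.
Proof. by case: a b => [] []; congr ((_, _), (_, _)); rewrite /=; ring. Qed.

(** Since p times A^sharp lies in A, single components of an element of M can be changed by
    multiples of p inside M. *)
Lemma ex_idem_in_A a b : exists w : Aring p, Aval w = Sconst p * idem a b.
Proof.
have wP : Sconst p * idem a b \in Apred p.
  case: a b => [] []; apply/ApredP;
  [exists 0, 0, 0, 1 | exists 0, 1, 0, 0 | exists 0, 0, 1, 0
  | exists p, (-1), (-1), (-1)];
  by congr ((_, _), (_, _)); rewrite /=; ring.
by exists (ARing wP).
Qed.

Definition sharp_coord (a b : bool) (s : Asharp R) : R :=
  match a, b with
  | true, true => s.1.1 | true, false => s.1.2
  | false, true => s.2.1 | false, false => s.2.2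
  end.

Lemma idem_coord a b (s : Asharp R) :
  idem a b * s = Sconst (sharp_coord a b s) * idem a b.
Proof.
case: s => [[s1 s2] [s3 s4]].
by case: a b => [] []; congr ((_, _), (_, _)); rewrite /=; ring.
Qed.

Variables (M : lattice (Aring p)) (V : quiver_rep k).
Variables (S : lattice (Asharp R)).
Variable j : {linear M -> restrict (@AtoAsharp R p) S}.
Hypothesis jP : is_sharp j.
Variable qc : overR M -> restrict res 'cV[k]_(vcent V).
Variable q : forall a b, overR S -> restrict res 'cV[k]_(vdim V a b).
Hypothesis qcP : is_quotient [set: overR M]%classic (@mM _ _ M) qc.
Hypothesis qP : forall a b, is_quotient (@weight_space _ p S a b)
  [set s | exists2 s', @weight_space _ p S a b s' & s = p *: s']%classic
  (q a b).
Hypothesis qj : forall a b u,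
  q a b (idem a b *: (j u : S)) = vmap V a b *m qc u.

Definition emb (u : M) : S := j u.

Lemma embZ a u : emb (a *: u) = Aval a *: emb u.
Proof. exact: (linearZ_LR j a u). Qed.

Lemma embD u v : emb (u + v) = emb u + emb v.
Proof. exact: (linearD j). Qed.

Lemma emb_sum (I : finType) (F : I -> M) : emb (\sum_i F i) = \sum_i emb (F i).
Proof. exact: (linear_sum j). Qed.

Lemma emb_inj : injective emb.
Proof. by case: jP. Qed.

Lemma emb0 : emb 0 = 0.
Proof. exact: (linear0 j). Qed.

Lemma sharp_cancel (s t : S) : Sconst p *: s = Sconst p *: t -> s = t.
Proof.
rewrite -SconstE => st; apply/eqP; rewrite -subr_eq0; apply/eqP.
by apply: (lattice_torsion_free p0); rewrite scalerBr st subrr.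
Qed.

Lemma sharp_expand (s : S) : s = \sum_(i : bool * bool) idem i.1 i.2 *: s.
Proof.
rewrite -scaler_suml -{1}[s]scale1r; congr (_ *: _).
rewrite -(pair_bigA _ idem) !big_bool /= -idem_sum.
by rewrite !addrA.
Qed.

Lemma weightP a b (s : S) :
  @weight_space _ p S a b s <-> idem a b *: s = s.
Proof.
split=> [[]|<-]; last first.
  by split; rewrite !scalerA SconstE ?sx_idem ?sy_idem.
rewrite !SconstE => sxs sys; rewrite [RHS]sharp_expand (bigD1 (a, b)) //=.
rewrite big1 ?addr0 // => -[a' b'] /= neq.
have X : Sconst (if a' then p else 0) *: (idem a' b' *: s) =
         Sconst (if a then p else 0) *: (idem a' b' *: s).
  by rewrite scalerA -sx_idem mulrC -scalerA sxs !scalerA mulrC.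
have Y : Sconst (if b' then p else 0) *: (idem a' b' *: s) =
         Sconst (if b then p else 0) *: (idem a' b' *: s).
  by rewrite scalerA -sy_idem mulrC -scalerA sys !scalerA mulrC.
have S0 : Sconst 0 = 0 by [].
apply: sharp_cancel; rewrite scaler0.
case: a b a' b' X Y neq {sxs sys} => [] [] [] []; rewrite ?S0 ?scale0r //.
Qed.

Lemma weight_idem a b (s : S) : @weight_space _ p S a b (idem a b *: s).
Proof. by apply/weightP; rewrite scalerA idem_id. Qed.

(** A^sharp acts on a weight component through R, so on one component its coefficients can be
    replaced by scalars: M maps onto each component. *)
Lemma weight_emb a b (s : S) : exists m, idem a b *: s = idem a b *: emb m.
Proof.
have [_ gen] := jP; have [n [cs [u ->]]] := gen s.
exists (\sum_i (sharp_coord a b (cs i))%:A *: u i).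
rewrite emb_sum !scaler_sumr; apply: eq_bigr => i _.
rewrite embZ !scalerA; congr (_ *: _).
have -> : Aval ((sharp_coord a b (cs i))%:A : Aring p) =
    Sconst (sharp_coord a b (cs i)).
  exact: Aval_const.
by rewrite idem_coord mulrC.
Qed.

Lemma q_lincomb a b (r : R) (s t : S) :
  idem a b *: s = s -> idem a b *: t = t ->
  q a b (r *: (s : overR S) + t) = r *: q a b s + q a b t.
Proof.
move=> /weightP ws /weightP wt; have [ql _ _] := qP a b; exact: ql.
Qed.

Lemma qD a b (s t : S) : idem a b *: s = s -> idem a b *: t = t ->
  q a b (s - t) = q a b s - q a b t.
Proof.
move=> ws wt.
have := q_lincomb (-1) wt ws.
have -> : (-1 *: (t : overR S) + s) = s - t by rewrite scaleN1r addrC.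
by move=> ->; rewrite scaleN1r addrC.
Qed.

Lemma q_ker a b (s : S) : idem a b *: s = s ->
  q a b s = 0 <-> exists m, s = Sconst p *: (idem a b *: emb m).
Proof.
move=> ws; have /weightP wt := ws; have [_ _ qk] := qP a b.
split=> [/(qk _ wt)[s' /weightP ws' sE]|[m sE]].
  have [m mE] := weight_emb a b s'; exists m.
  by rewrite -mE ws' -SconstE.
apply/(qk _ wt); exists (idem a b *: emb m); first exact: weight_idem.
by rewrite {1}sE -SconstE.
Qed.

Lemma vmap_surj a b (w : 'cV_(vdim V a b)) : exists v, vmap V a b *m v = w.
Proof.
have [_ qs _] := qP a b; have [s /weightP ws qE] := qs w.
have [m mE] := weight_emb a b s.
by exists (qc m); rewrite -qj -[j m]/(emb m) -mE ws.
Qed.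

(** * Exactness read off from the representation *)

Section GenExact.
Variable c : bool.

Hypothesis joint_surj : forall (e : bool)
  (w : forall a, 'cV[k]_(vdim V (idx1 c a e) (idx2 c a e))),
  exists v, forall a, vmap V (idx1 c a e) (idx2 c a e) *m v = w a.
Hypothesis dimV : forall e, vcent V =
  (vdim V (idx1 c true e) (idx2 c true e) +
   vdim V (idx1 c false e) (idx2 c false e))%N.

Lemma joint_inj e (v : 'cV_(vcent V)) :
  (forall a, vmap V (idx1 c a e) (idx2 c a e) *m v = 0) -> v = 0.
Proof.
move=> v0.
pose d1 := vdim V (idx1 c true e) (idx2 c true e).
pose d2 := vdim V (idx1 c false e) (idx2 c false e).
pose C : 'M_(d1 + d2, vcent V) := col_mx (vmap V _ _) (vmap V _ _).
have surjC (w : 'cV_(d1 + d2)) : exists u, C *m u = w.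
  have [u uE] := joint_surj (fun a => if a as a' return
    'cV[k]_(vdim V (idx1 c a' e) (idx2 c a' e)) then usubmx w else dsubmx w).
  by exists u; rewrite mul_col_mx (uE true) (uE false) vsubmxK.
have [f fE] := choice (fun i => surjC (delta_mx i 0)).
pose B := \matrix_(i, l) f l i 0.
have CB : C *m B = 1%:M.
  apply/matrixP => i l; rewrite [LHS]mxE [RHS]mxE.
  have /(congr1 (fun A : 'cV_(d1 + d2) => A i 0)) := fE l.
  rewrite [X in X = _]mxE [X in _ = X]mxE andbT => <-.
  by apply: eq_bigr => h _; rewrite [B _ _]mxE.
have fullC : row_full C.
  rewrite /row_full eqn_leq rank_leq_col /=.
  apply: (leq_trans (eq_leq (dimV e))).
  by have := mxrankM_maxl C B; rewrite CB mxrank1.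
have /row_fullP[B' B'C] := fullC.
have Cv : C *m v = 0 by rewrite mul_col_mx (v0 true) (v0 false) col_mx0.
by rewrite -[v]mul1mx -B'C -mulmxA Cv mulmx0.
Qed.

Lemma radical_emb (u : M) : qc u = 0 -> exists t, emb u = Sconst p *: t.
Proof.
have [_ _ qk] := qcP => /(qk u I)[u1 [u2 [u3 [u4 ->]]]].
(* In A^sharp, x, y and z are p times sums of idempotents: those with a = p, those with b = p, and
   pp alone. *)
exists (emb u1 + (idem true true + idem true false) *: emb u2
  + (idem true true + idem false true) *: emb u3 + idem true true *: emb u4).
rewrite !embD !embZ !scalerDr !scalerA.
have pE : Aval (p%:A : Aring p) = Sconst p.
  exact: Aval_const.
rewrite pE; congr (_ + _ *: _ + _ *: _ + _ *: _);
  by congr ((_, _), (_, _)); rewrite /=; ring.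
Qed.

(** Joint surjectivity lifts both components modulo p; the errors, multiples of p, are then removed
    one component at a time. *)
Lemma joint_lift e (t : S) : exists m, forall a,
  idem (idx1 c a e) (idx2 c a e) *: emb m = idem (idx1 c a e) (idx2 c a e) *: t.
Proof.
have [v vE] := joint_surj (fun a => q (idx1 c a e) (idx2 c a e)
  (idem (idx1 c a e) (idx2 c a e) *: t)).
have [_ qs _] := qcP; have [m1 _ m1E] := qs v.
have step a : exists n, idem (idx1 c a e) (idx2 c a e) *: t
    - idem (idx1 c a e) (idx2 c a e) *: emb m1 =
    Sconst p *: (idem (idx1 c a e) (idx2 c a e) *: emb n).
  apply/q_ker; first by rewrite scalerBr !scalerA idem_id.
  rewrite qD ?scalerA ?idem_id //; apply/eqP; rewrite subr_eq0; apply/eqP.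
  by rewrite -vE [RHS]qj m1E.
have [n nE] := choice step.
have [w wE] := choice (fun a => ex_idem_in_A (idx1 c a e) (idx2 c a e)).
exists (m1 + \sum_a w a *: n a) => a.
rewrite embD emb_sum scalerDr scaler_sumr (bigD1 a) //= big1 ?addr0.
  rewrite embZ wE !scalerA [_ * (Sconst p * _)]mulrCA idem_id -scalerA -nE.
  by rewrite addrC subrK.
move=> a' neq; rewrite embZ wE !scalerA mulrCA idem_orth ?mulr0 ?scale0r //.
by rewrite /idx1 /idx2; case: (c); rewrite xpair_eqE eqxx ?andbT eq_sym.
Qed.

Lemma Kscale_emb (a : K) (u : restrictK M) : emb (a *: u) = Kval a *: emb u.
Proof. exact: embZ. Qed.

Lemma gen_idem a e :
  Kval (gen (~~ c)) * idem (idx1 c a e) (idx2 c a e) =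
  Sconst (if e then p else 0) * idem (idx1 c a e) (idx2 c a e).
Proof. by rewrite Kval_gen; case: c => /=; rewrite ?sx_idem ?sy_idem. Qed.

Lemma sharp_eq (s t : S) : (forall e a,
  idem (idx1 c a e) (idx2 c a e) *: s = idem (idx1 c a e) (idx2 c a e) *: t) ->
  s = t.
Proof.
move=> st; rewrite [LHS]sharp_expand [RHS]sharp_expand.
apply: eq_bigr => -[a b] _ /=.
by case: c st => st; [exact: (st b a)|exact: (st a b)].
Qed.

(* [Z] and [Z'] stand for gen and gen - p, in either order. *)
Let exact_step (Z Z' : K) e0 (r r' : R) :
  (forall a e, Kval Z * idem (idx1 c a e) (idx2 c a e) =
     Sconst (if e == e0 then r * p else 0) * idem (idx1 c a e) (idx2 c a e)) ->
  (forall a e, Kval Z' * idem (idx1 c a e) (idx2 c a e) =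
     Sconst (if e == e0 then 0 else r' * p) * idem (idx1 c a e) (idx2 c a e)) ->
  r * r = 1 -> r' * r' = 1 ->
  forall m : restrictK M, Z *: m = 0 -> exists m', m = Z' *: m'.
Proof.
move=> ZE Z'E rr rr' m Zm.
have SM (x y : R) : Sconst (x * y) = Sconst x * Sconst y by [].
have S0 : Sconst 0 = 0 by [].
have m0 a : idem (idx1 c a e0) (idx2 c a e0) *: emb m = 0.
  apply: sharp_cancel; rewrite scaler0.
  have : Kval Z *: emb m = 0 by rewrite -Kscale_emb Zm emb0.
  move=> /(congr1 (fun s =>
    Sconst r *: (idem (idx1 c a e0) (idx2 c a e0) *: s))).
  rewrite !scaler0 (scalerA _ (Kval Z)) (mulrC _ (Kval Z)) ZE eqxx !scalerA.
  by rewrite (mulrA (Sconst r)) -SM mulrA rr mul1r.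
(* [m] has no components of weight [e0], so joint injectivity puts it in the radical; on weight
   [~~ e0], where [Z'] acts as p up to sign, it can then be divided by [Z']. *)
have [t tE] : exists t, emb m = Sconst p *: t.
  apply: radical_emb; apply: (@joint_inj e0) => a.
  rewrite -qj -[j m]/(emb m) m0.
  apply/q_ker; first by rewrite scaler0.
  by exists 0; rewrite emb0 !scaler0.
have [m' m'E] := joint_lift (~~ e0) (Sconst r' *: t).
exists m'; apply: emb_inj; apply: sharp_eq => e a.
rewrite Kscale_emb scalerA [_ * Kval Z']mulrC Z'E.
have [->|ne] := eqVneq e e0; first by rewrite m0 S0 mul0r scale0r.
have -> : e = ~~ e0 by move: ne; case: (e); case: (e0).
rewrite -scalerA m'E tE SM !scalerA; congr (_ *: _).
have r1 : Sconst r' * Sconst r' = 1 by rewrite -SM rr'.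
by rewrite -[LHS]mul1r -r1; ring.
Qed.

Lemma Phi_gen_exact : gen_exact (~~ c) (restrictK M).
Proof.
have genB a e : Kval (gen (~~ c) - p%:K) * idem (idx1 c a e) (idx2 c a e) =
    Sconst (if e then 0 else (-1) * p) * idem (idx1 c a e) (idx2 c a e).
  rewrite KvalB Kval_const mulrBl gen_idem -mulrBl; congr (_ * _).
  by case: e; congr ((_, _), (_, _)); rewrite /=; ring.
split=> m.
  apply: (@exact_step _ _ true 1 (-1)); rewrite ?mulr1 ?mulrNN ?mulr1 //.
    by move=> a e; rewrite gen_idem eqb_id mul1r.
  by move=> a e; rewrite genB eqb_id.
apply: (@exact_step _ _ false (-1) 1); rewrite ?mulr1 ?mulrNN ?mulr1 //.
  by move=> a e; rewrite genB; case: e.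
by move=> a e; rewrite gen_idem mul1r; case: e.
Qed.
End GenExact.

(** * Degree zero as one of the spaces of the representation *)

Section WeightHomology.
Variables a0 b0 : bool.

Definition weight_homology : subquotient R :=
  @Subquotient R (overR M)
    [set u | idem a0 b0 *: emb u = emb u]%classic
    [set u | exists n,
       emb u = (Sconst p * Sconst p) *: (idem a0 b0 *: emb n)]%classic.

Hypothesis weight_divisible : forall u, idem a0 b0 *: emb u = emb u ->
  exists n, emb u = Sconst p *: (idem a0 b0 *: emb n).

(** Divisibility makes the numerator p times the weight component of M^sharp, and the denominator is
    p^2 times it; dividing by p leaves V at this weight. *)
Lemma weight_homology_iso :
  sq_iso weight_homology (restrict res 'rV[k]_(vdim V a0 b0)).
Proof.
have ch u : exists s, idem a0 b0 *: emb u = emb u ->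
    idem a0 b0 *: s = s /\ emb u = Sconst p *: s.
  have [wu|nwu] := pselect (idem a0 b0 *: emb u = emb u); last by exists 0.
  have [n nE] := weight_divisible wu; exists (idem a0 b0 *: emb n) => _.
  by rewrite scalerA idem_id.
have [f fP] := choice ch.
exists (fun u => (q a0 b0 (f u) : 'cV[k]_(vdim V a0 b0))^T); split.
- move=> r u v wu wv.
  have embl : emb (r *: u + v) = Sconst r *: emb u + emb v.
    by rewrite embD -Aval_const -embZ.
  have wr : idem a0 b0 *: emb (r *: u + v) = emb (r *: u + v).
    by rewrite embl scalerDr wv scalerA mulrC -scalerA wu.
  have [wf fE] := fP _ wu; have [wg gE] := fP _ wv; have [wh hE] := fP _ wr.
  have -> : f (r *: u + v) = r *: (f u : overR S) + f v.
    apply: sharp_cancel; rewrite -hE embl fE gE scalerDr.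
    congr (_ + _); transitivity (Sconst p *: (r%:A *: f u)); last by [].
    by rewrite SconstE !scalerA mulrC.
  rewrite (q_lincomb _ wf wg).
  exact: (linearP (@trmx k _ _)).
- move=> w; have [_ qs _] := qP a0 b0.
  have [s /weightP ws qE] := qs (w : 'rV[k]_(vdim V a0 b0))^T.
  have [n nE] := weight_emb a0 b0 s; have [x xE] := ex_idem_in_A a0 b0.
  have xnE : emb (x *: n) = Sconst p *: s.
    by rewrite embZ xE -scalerA -nE ws.
  have wx : idem a0 b0 *: emb (x *: n) = emb (x *: n).
    by rewrite xnE scalerA mulrC -scalerA ws.
  exists (x *: n) => //.
  have [_ fE] := fP _ wx.
  have -> : f (x *: n) = s by apply: sharp_cancel; rewrite -fE.
  by rewrite qE trmxK.
- move=> u wu; have [wf fE] := fP _ wu; split.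
    move=> /(congr1 trmx); rewrite trmxK trmx0 => /(q_ker wf)[n nE].
    by exists n; rewrite fE nE scalerA.
  move=> [n nE].
  have -> : q a0 b0 (f u) = 0; last exact: trmx0.
  by apply/(q_ker wf); exists n; apply: sharp_cancel; rewrite -fE nE !scalerA.
Qed.
End WeightHomology.

Lemma weight_tate0_iso (P : free_resolution (Rpp p)) (N : lmodType K)
    (f : N -> restrictK M) (g : restrictK M -> N) a0 b0 (x : K) :
  cancel f g -> cancel g f -> Rlinear f ->
  (forall u, Kinvariant u <-> idem a0 b0 *: emb (f u) = emb (f u)) ->
  Kval x = Sconst p * Sconst p * idem a0 b0 ->
  (forall v, f ((Kx p * Ky p) *: v) = x *: f v) ->
  (forall u, idem a0 b0 *: emb u = emb u ->
     exists n, emb u = Sconst p *: (idem a0 b0 *: emb n)) ->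
  sq_iso (tate P N 0) (restrict res 'rV[k]_(vdim V a0 b0)).
Proof.
move=> fK gK fl invE xE fx div.
apply: (@sq_iso_correspondence R (weight_homology a0 b0) (tate P N 0) _
  (fun u u' => (u : M) = f u')); last exact: weight_homology_iso.
- move=> r u v wu wv.
  have embl : emb (r *: u + v) = Sconst r *: emb u + emb v.
    by rewrite embD -Aval_const -embZ.
  by rewrite /= embl scalerDr wv scalerA mulrC -scalerA wu.
- by move=> r u v; exact: invariant_lincomb.
- move=> r u v u' v' -> ->; apply: esym; apply: etrans (fl r u' v') _.
  congr (_ + _); transitivity (KtoA r%:K *: (f u' : M)); first by [].
  by rewrite KtoA_scalar.
- by move=> u wu; exists (g u); [apply/invE; rewrite gK|rewrite gK].
- by move=> u' /invE wu; exists (f u').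
- move=> u u' _ _ ->; split=> [[n nE]|[v ->]].
    exists (g n); apply: (can_inj fK); rewrite fx gK.
    by apply: emb_inj; rewrite nE Kscale_emb xE -!scalerA.
  by exists (f v); rewrite fx Kscale_emb xE -!scalerA.
Qed.

(** Invariants of M have weight p for both generators; in M' the weight for [gen c] becomes 0.
    Exactness writes such an element as [gen (~~ c)] times another one, and [gen (~~ c)] acts as p
    on its component: this is the required divisibility. *)
Lemma tate0_iso (P : free_resolution (Rpp p)) c b :
  gen_exact (~~ c) (restrictK M) ->
  sq_iso (tate P (twist c (restrictK M) b) 0)
    (restrict res 'rV[k]_(vdim V (idx1 c (~~ b) true) (idx2 c (~~ b) true))).
Proof.
move=> [_ exZ].
have divY (u : restrictK M) : gen (~~ c) *: u = p%:K *: u ->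
    exists n, emb u = Kval (gen (~~ c)) *: emb n.
  move=> Yu; have [|n ->] := exZ u; first by rewrite scalerBl Yu subrr.
  by exists n; exact: Kscale_emb.
have weightE a (u : restrictK M) :
    idem (idx1 c a true) (idx2 c a true) *: emb u = emb u <->
    gen c *: u = (if a then p else 0)%:K *: u /\ gen (~~ c) *: u = p%:K *: u.
  have KE (b' : K) (r : R) : b' *: u = r%:K *: u <->
      Kval b' *: emb u = Sconst r *: emb u.
    rewrite -Kscale_emb -[Sconst r](Kval_const p) -Kscale_emb.
    by split=> [->|/emb_inj].
  rewrite !KE; apply: iff_trans (iff_sym (weightP _ _ _)) _.
  rewrite /weight_space /= !SconstE !Kval_gen /idx1 /idx2.
  by case: (c) => //=; split=> -[].
have div a (u : restrictK M) :
    idem (idx1 c a true) (idx2 c a true) *: emb u = emb u ->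
    exists n, emb u =
      Sconst p *: (idem (idx1 c a true) (idx2 c a true) *: emb n).
  move=> wu; have /weightE[_ Yu] := wu; have [n nE] := divY u Yu.
  by exists n; rewrite -wu nE scalerA mulrC gen_idem -scalerA.
case: b => /=.
  apply: (@weight_tate0_iso P (twist c (restrictK M) true) id id _ _
    (flip c (Kx p * Ky p))) => //.
  - move=> r u v; congr (_ + _).
    transitivity (flip c r%:K *: (u : restrictK M)); first by [].
    by rewrite flip_const.
  - move=> u; apply: iff_trans (iff_sym (weightE false u)).
    by rewrite /= Kconst0 scale0r; exact: invariant_twist.
  - rewrite Kval_flip KvalM KvalKx KvalKy.
    by case: (c); congr ((_, _), (_, _)); rewrite /=; ring.
  - exact: (div false).
apply: (@weight_tate0_iso P (restrictK M) id id _ _ (Kx p * Ky p)) => //.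
- move=> u; apply: iff_trans (iff_sym (weightE true u)).
  by rewrite /Kinvariant; case: (c) => //; split=> -[].
- rewrite KvalM KvalKx KvalKy.
  by case: (c); congr ((_, _), (_, _)); rewrite /=; ring.
- exact: (div true).
Qed.
End PhiAnalysis.

(** * The tubes *)

Section Tubes.
Variables (R : idomainType) (p : R) (k : fieldType) (res : {rmorphism R -> k}).
Hypothesis dvr : complete_dvr p.
Let p0 : p != 0 := cdvr_neq0 dvr.

Lemma tate_of_Phi (P : free_resolution (Rpp p)) (M : lattice (Aring p))
    (V : quiver_rep k) c (n : int) :
  is_Phi res M V -> gen_exact (~~ c) (restrictK M) ->
  sq_iso (tate P (restrictK M) n)
    (restrict res 'rV[k]_(vdim V (idx1 c (~~ odd `|n|%N) true)
                                 (idx2 c (~~ odd `|n|%N) true))).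
Proof.
move=> [S [j [jP [qc [q [qcP qP qj]]]]]] ex.
have dvd := complete_dvr_dvd_total dvr.
apply: (tate_iso p0 dvd (c := c)) => //.
  exact: gen_exact_relatively_projective.
exact: (tate0_iso p0 jP qP P (odd `|n|%N) ex).
Qed.

Lemma Phi_exact c (M : lattice (Aring p)) (V : quiver_rep k) :
  is_Phi res M V ->
  (forall (e : bool) (w : forall a, 'cV[k]_(vdim V (idx1 c a e) (idx2 c a e))),
    exists v, forall a, vmap V (idx1 c a e) (idx2 c a e) *m v = w a) ->
  (forall e, vcent V = (vdim V (idx1 c true e) (idx2 c true e) +
                        vdim V (idx1 c false e) (idx2 c false e))%N) ->
  gen_exact (~~ c) (restrictK M).
Proof.
move=> [S [j [jP [qc [q [qcP qP qj]]]]]] surj dim.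
exact: (Phi_gen_exact p0 jP qcP qP qj surj dim).
Qed.

(** The case of the exceptional T_1: one space of each pair is zero, and the map to the other is
    surjective for every lattice. *)
Lemma thin_Phi_exact c (M : lattice (Aring p)) (V : quiver_rep k) :
  is_Phi res M V ->
  (forall e, exists2 a, vdim V (idx1 c (~~ a) e) (idx2 c (~~ a) e) = 0%N &
     vdim V (idx1 c a e) (idx2 c a e) = vcent V) ->
  gen_exact (~~ c) (restrictK M).
Proof.
move=> Phi thin; apply: (Phi_exact Phi) => e; have [a d0 d1] := thin e.
  move=> w; have [S [j [jP [qc [q [_ qP qj]]]]]] := Phi.
  have [v vE] := vmap_surj p0 jP qP qj (w a).
  exists v => a'; have [->|ne] := eqVneq a' a; first exact: vE.
  have -> : a' = ~~ a by case: a' a ne {vE d0 d1} => [] [].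
  by apply/matrixP => i; have := ltn_ord i; rewrite {2}d0.
by case: a d0 d1 => /= d0 d1; rewrite d0 d1 ?addn0.
Qed.

Lemma homogeneous_tube_exact f (T : nat -> lattice (Aring p)) :
  is_homogeneous_tube res f T ->
  forall m, (0 < m)%N -> gen_exact (~~ true) (restrictK (T m)).
Proof.
move=> tube.
have base : gen_exact (~~ true) (restrictK (T 1)).
  apply: (Phi_exact (hom_first tube)) => // e w.
  (* The two joint maps have block matrices (I 0; I I) and (0 I; I F), solved by elimination. *)
  case: e w => w /=.
    exists (col_mx (w true) (w false - w true)) => -[] /=.
      by rewrite mul_row_col mul1mx mul0mx addr0.
    by rewrite mul_row_col !mul1mx addrC subrK.
  exists (col_mx (w false - companionmx f *m w true) (w true)) => -[] /=.
    by rewrite mul_row_col mul1mx mul0mx add0r.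
  by rewrite mul_row_col mul1mx subrK.
case=> // m _; elim: m => [//|m IHm].
have [g [h gh]] := hom_ext_quo tube (ltn0Sn m).
exact: (gen_exact_extension gh IHm base).
Qed.

(** For lambda = oo the spaces at pp and 0p of T_1 are both nonzero or both zero, so V cannot be
    compared with their sum; pairing pp with p0 works instead. *)
Definition tube_dir (lam : exceptional_index) :=
  if lam is LambdaInf then false else true.

Lemma exceptional_tube_exact lam (T : nat -> nat -> lattice (Aring p)) :
  is_exceptional_tube res lam T ->
  forall i m, i \in [:: 1; 2]%N -> (0 < m)%N ->
  gen_exact (~~ tube_dir lam) (restrictK (T i m)).
Proof.
move=> tube.
have base i : i \in [:: 1; 2]%N ->
    gen_exact (~~ tube_dir lam) (restrictK (T i 1)).
  rewrite !inE => /orP[]/eqP->.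
    have [V [Phi dc dV]] := exc_rank_odd1 tube (ltn0Sn 0).
    apply: (thin_Phi_exact Phi) => e; rewrite dc.
    by case: lam {tube} dV => dV; case: e; rewrite /=;
      (exists true; rewrite /= dV; done) ||
      (exists false; rewrite /= dV; done).
  have [V [Phi dc dV]] := exc_rank_odd2 tube (ltn0Sn 0).
  apply: (thin_Phi_exact Phi) => e; rewrite dc.
  by case: lam {tube} dV => dV; case: e; rewrite /=;
    (exists true; rewrite /= dV; done) || (exists false; rewrite /= dV; done).
move=> i m iP; case: m => // m _; elim: m => [|m IHm]; first exact: base.
have [g [h [_ gh]]] := exc_mono tube iP (ltn0Sn m).
apply: (gen_exact_extension gh IHm); apply: base.
by move: iP; case: (odd _); rewrite !inE => /orP[]/eqP->.
Qed.

Lemma sign_exprz (n : int) : (-1) ^ n = (-1) ^+ odd `|n|%N :> int.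
Proof.
rewrite signr_odd; case: n => n //.
Qed.

Lemma odd_tube_dim (i h : nat) (n : int) : i \in [:: 1; 2]%N ->
  `|(((2 * h.+1 - 1)%N%:Z - (-1) ^ (n + i%:Z)) %/ 2)%Z|%N =
  if ~~ odd `|n|%N (+) (i == 1)%N then h else h.+1.
Proof.
move=> iP; rewrite exprzDr ?unitrN1 // sign_exprz (sign_exprz i%:Z) -signr_addb.
have -> : (2 * h.+1 - 1)%N%:Z = h%:Z * 2 + 1.
  by rewrite mulnS addSn subn1 /= PoszD PoszM mulrC addrC.
have -> : ~~ odd `|n|%N (+) (i == 1)%N = ~~ (odd `|n|%N (+) odd i).
  by move: iP; rewrite !inE => /orP[]/eqP->; case: (odd `|n|%N).
rewrite absz_nat; case: (_ (+) _).
  rewrite expr1 opprK -addrA -[1 + 1]/(1 * 2 : int) -mulrDl mulzK //.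
  by rewrite -PoszD addn1.
by rewrite expr0 addrK mulzK.
Qed.

Lemma sq_iso_dim (H : subquotient R) (d d' : nat) : d = d' ->
  sq_iso H (restrict res 'rV[k]_d) -> sq_iso H (restrict res 'rV[k]_d').
Proof. by move->. Qed.

Lemma tate_homogeneous_tube (P : free_resolution (Rpp p)) f
    (T : nat -> lattice (Aring p)) (n : int) (m : nat) :
  is_homogeneous_tube res f T -> (0 < m)%N ->
  sq_iso (tate P (restrictK (T m)) n)
    (restrict res 'rV[k]_((size f).-1 * m)).
Proof.
move=> tube m0; have [V [Phi _ dV]] := hom_rank tube m0.
apply: sq_iso_dim (tate_of_Phi P n Phi (homogeneous_tube_exact tube m0)).
exact: dV.
Qed.

(** For lambda = 0 the interchange fixes the vertices with b = p; for lambda = oo it is undone by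
    the exchange of the two generators in [tube_dir]. *)
Lemma swap_rank_idx lam d a :
  (forall a b, d a b = d a true) ->
  swap_rank lam d (idx1 (tube_dir lam) a true) (idx2 (tube_dir lam) a true) =
  d a true.
Proof. by case: lam. Qed.

Lemma tate_exceptional_tube (P : free_resolution (Rpp p)) lam
    (T : nat -> nat -> lattice (Aring p)) (i : nat) (n : int) (m : nat) :
  is_exceptional_tube res lam T -> i \in [:: 1; 2]%N -> (0 < m)%N ->
  sq_iso (tate P (restrictK (T i m)) n)
    (restrict res 'rV[k]_(
       if odd m then `|((m%:Z - (-1) ^ (n + i%:Z)) %/ 2)%Z|%N else m./2)).
Proof.
move=> tube iP m0.
have ex := exceptional_tube_exact tube iP m0.
have [modd|meven] := boolP (odd m); last first.
  have mE : m = (2 * m./2)%N.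
    by rewrite mul2n -[LHS]odd_double_half (negPf meven).
  have h0 : (0 < m./2)%N by rewrite -(ltn_pmul2l (isT : 0 < 2)%N) muln0 -mE.
  have [V [Phi _ dV]] := exc_rank_even tube iP h0.
  rewrite -mE in Phi; apply: sq_iso_dim (tate_of_Phi P n Phi ex).
  by rewrite dV swap_rank_idx.
have mE : m = (2 * (m./2).+1 - 1)%N.
  by rewrite mulnS addSn subn1 /= mul2n -[LHS]odd_double_half modd.
have dimE : `|((m%:Z - (-1) ^ (n + i%:Z)) %/ 2)%Z|%N =
    if ~~ odd `|n|%N (+) (i == 1)%N then m./2 else (m./2).+1.
  by rewrite {1}mE odd_tube_dim.
have [V [Phi dV]] : exists V, is_Phi res (T i m) V /\
    forall a, vdim V (idx1 (tube_dir lam) a true) (idx2 (tube_dir lam) a true)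
      = if a (+) (i == 1)%N then m./2 else (m./2).+1.
  move: iP; rewrite !inE => /orP[]/eqP->.
    have [V [Phi _ dV]] := exc_rank_odd1 tube (ltn0Sn m./2).
    rewrite -mE in Phi; exists V; split=> // a.
    by rewrite dV swap_rank_idx // subn1; case: a.
  have [V [Phi _ dV]] := exc_rank_odd2 tube (ltn0Sn m./2).
  rewrite -mE in Phi; exists V; split=> // a.
  by rewrite dV swap_rank_idx // subn1; case: a.
by apply: sq_iso_dim (tate_of_Phi P n Phi ex); rewrite dV dimE.
Qed.
End Tubes.

Theorem theorem2p6 (R : idomainType) (p : R) (k : fieldType)
    (res : {rmorphism R -> k}) (P : free_resolution (Rpp p)) :
  complete_dvr p -> is_residue_map p res ->
  (forall f : {poly k},
     f \is monic -> irreducible_poly f -> f != 'X -> f != 'X - 1 ->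
   forall T : nat -> lattice (Aring p), is_homogeneous_tube res f T ->
   forall (n : int) (m : nat), (0 < m)%N ->
     sq_iso (tate P (restrictK (T m)) n)
       (restrict res 'rV[k]_((size f).-1 * m)))
  /\
  (forall (lam : exceptional_index) (T : nat -> nat -> lattice (Aring p)),
     is_exceptional_tube res lam T ->
   forall (i : nat) (n : int) (m : nat), i \in [:: 1; 2]%N -> (0 < m)%N ->
     sq_iso (tate P (restrictK (T i m)) n)
       (restrict res 'rV[k]_(
          if odd m then `|((m%:Z - (-1) ^ (n + i%:Z)) %/ 2)%Z|%N else m./2))).
Proof.
move=> dvr _; split=> [f _ _ _ _ T tube n m|lam T tube i n m].
  exact: (tate_homogeneous_tube dvr P n tube).
exact: (tate_exceptional_tube dvr P n tube).
Qed.
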